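(* The generating function for $312$-avoiding perfect matchings is $$\sum_{n\ge 0}|\mathcal{M}_n(312)|z^n=\frac{54z}{1+36z-(1-12z)^{3/2}},$$ and $$|\mathcal{M}_n(312)|\sim\frac{3^3}{2^7\sqrt{\pi n^5}}\,12^n\qquad(n\to\infty).$$
   Context: $\mathcal{M}_n(\tau)$ is the set of perfect matchings $M$ of $[2n]$ (sets of $n$ disjoint pairs $(i,j)$, $i<j$, covering $[2n]$) that avoid $\tau\in S_k$, meaning there are no $i_1<\dots<i_{2k}$ such that $M$ contains all pairs $(i_a,i_{2k+1-\tau(a)})$, $1\le a\le k$. For $\tau=312$: no three arcs $(i_1,i_4),(i_2,i_6),(i_3,i_5)$ with $i_1<\dots<i_6$. *)

(* Defs.v *)
From mathcomp Require Import all_boot all_fingroup.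

Set Implicit Arguments.
Unset Strict Implicit.
Unset Printing Implicit Defensive.

(* The ground set [2n] = {1, ..., 2n} is 'I_(2 * n), shifted to start at 0;
   a pair (i, j) is an element of 'I_(2 * n) * 'I_(2 * n). *)

Definition ends (n : nat) (p : 'I_(2 * n) * 'I_(2 * n)) : {set 'I_(2 * n)} :=
  [set p.1; p.2].

Definition perfect_matching (n : nat) (M : {set 'I_(2 * n) * 'I_(2 * n)}) :
    bool :=
  [&& #|M| == n,
      [forall p in M, (p.1 < p.2)%N],
      [forall p in M, forall q in M,
         (p != q) ==> [disjoint ends p & ends q]]
    & \bigcup_(p in M) ends p == [set: 'I_(2 * n)]].

(* With every index shifted by one, 2k + 1 - tau(a) becomes
   2k - 1 - tau a, which is the value of rev_ord at tau a in 'I_(k + k). *)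
Definition contains_pattern (n k : nat) (M : {set 'I_(2 * n) * 'I_(2 * n)})
    (tau : 'S_k) : bool :=
  [exists i : {ffun 'I_(k + k) -> 'I_(2 * n)},
     [forall a : 'I_(k + k), forall b : 'I_(k + k), (a < b)%N ==> (i a < i b)%N]
     && [forall a : 'I_k,
           (i (lshift k a), i (rev_ord (lshift k (tau a)))) \in M]].

Definition matchings_avoiding (n k : nat) (tau : 'S_k) :
    {set {set 'I_(2 * n) * 'I_(2 * n)}} :=
  [set M | perfect_matching M & ~~ contains_pattern M tau].

(* One-line notation 312 on {1, 2, 3}, that is 201 on {0, 1, 2}. *)
Definition f312 (a : 'I_3) : 'I_3 :=
  tnth [tuple @Ordinal 3 2 isT; @Ordinal 3 0 isT; @Ordinal 3 1 isT] a.

Lemma f312_inj : injective f312.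
Proof.
by move=> [[|[|[|a]]] ha] [[|[|[|b]]] hb] // /(congr1 val) //= _; apply: val_inj.
Qed.

Definition p312 : 'S_3 := perm f312_inj.

(* Main.v *)
(** Read a matching from left to right and group the open arcs, in order of
    opening, into blocks within which arcs have to be closed first in, first
    out. A new arc forms a block of its own. Only the first arc of a block may
    close, and avoidance of 312 then forces all arcs opened after it to be closed
    in order of opening, so the rest of its block and all later blocks merge.
    Hence 312-avoiding matchings are closed walks on lists of block sizes.

    Let U(v) count walks from the empty list, with weight t per step and v per
    open arc, and let F = U(0) count closed walks. Cutting a walk at the last time
    the bottom block is modified gives
      t U^2 - (t + v - t v^2) F U + v F = 0.
    For small t > 0 the square root of the discriminant changes sign in v, so the
    discriminant has a double root; eliminating that root yields, with z = t^2,
      2 (1 + 4z)^2 F = 1 + 36z + (1 - 12z)^(3/2).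
    Comparing coefficients, this holds for |z| < 1/12, and 1 + 36z -
    (1 - 12z)^(3/2) is the conjugate factor:
      (1 + 36z)^2 - (1 - 12z)^3 = 108 z (1 + 4z)^2.
    The coefficients of (1 - 12z)^(3/2) are explicit, their asymptotics follow
    from Wallis' formula, and each division by 1 + 4z multiplies the leading
    constant by 1 / (1 + 4/12) = 3/4. *)

Require Import Defs.
From mathcomp Require Import all_boot all_order all_algebra all_fingroup.
From mathcomp Require Import zify ring lra.

Set Implicit Arguments.
Unset Strict Implicit.
Unset Printing Implicit Defensive.

Import Order.TTheory GRing.Theory Num.Theory.

Local Open Scope ring_scope.

(** * Walks on block states *)

Definition block (k : nat) : seq nat := if k is 0 then [::] else [:: k].

(* A state lists the sizes of the blocks of open arcs. Its successors are: a new
   block of size 1 is opened on top, or the first arc of some block closes, and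
   then what remains of that block merges with all later blocks. *)
Fixpoint succ_sum (V : nmodType) (phi : seq nat -> V) (s : seq nat) : V :=
  if s is b :: s' then
    succ_sum (fun x => phi (b :: x)) s' + phi (block (b + sumn s').-1)
  else phi [:: 1%N].

(** The step operator acts on functions of states, so its [m]-th iterate at the empty list sums
    [phi], with multiplicity, over the end states of all walks of [m] steps. *)
Definition walks (V : nmodType) (m : nat) (phi : seq nat -> V) : V :=
  iter m (@succ_sum V) phi [::].

Definition at_empty (R : pzSemiRingType) (s : seq nat) : R := (s == [::])%:R.

Lemma eq_succ_sum (V : nmodType) (phi psi : seq nat -> V) :
  phi =1 psi -> succ_sum phi =1 succ_sum psi.
Proof.
move=> E s; elim: s phi psi E => [|b s IH] phi psi E /=; first exact: E.
by rewrite (IH _ (fun x => psi (b :: x))) ?E // => x; rewrite E.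
Qed.

Lemma eq_iter_succ_sum (V : nmodType) m (phi psi : seq nat -> V) :
  phi =1 psi -> iter m (@succ_sum V) phi =1 iter m (@succ_sum V) psi.
Proof. by move=> E; elim: m => // m IH s /=; apply: eq_succ_sum. Qed.

Lemma eq_walks (V : nmodType) m (phi psi : seq nat -> V) :
  phi =1 psi -> walks m phi = walks m psi.
Proof. by move=> E; apply: eq_iter_succ_sum. Qed.

Lemma walksS (V : nmodType) m (phi : seq nat -> V) :
  walks m.+1 phi = walks m (succ_sum phi).
Proof. by rewrite /walks iterSr. Qed.

Lemma succ_sumD (V : nmodType) (phi psi : seq nat -> V) s :
  succ_sum (fun x => phi x + psi x) s = succ_sum phi s + succ_sum psi s.
Proof.
elim: s phi psi => [|b s IH] phi psi //=.
by rewrite (IH (fun x => phi (b :: x)) (fun x => psi (b :: x))) addrACA.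
Qed.

Lemma succ_sumZ (R : pzSemiRingType) (c : R) (phi : seq nat -> R) s :
  succ_sum (fun x => c * phi x) s = c * succ_sum phi s.
Proof.
elim: s phi => [|b s IH] phi //=.
by rewrite (IH (fun x => phi (b :: x))) mulrDr.
Qed.

Lemma walksD (V : nmodType) m (phi psi : seq nat -> V) :
  walks m (fun x => phi x + psi x) = walks m phi + walks m psi.
Proof.
elim: m phi psi => [|m IH] phi psi //.
by rewrite !walksS -IH; apply: eq_walks => s; rewrite succ_sumD.
Qed.

Lemma walksZ (R : pzSemiRingType) m (c : R) (phi : seq nat -> R) :
  walks m (fun x => c * phi x) = c * walks m phi.
Proof.
elim: m phi => [|m IH] phi //.
by rewrite !walksS -IH; apply: eq_walks => s; rewrite succ_sumZ.
Qed.

Lemma walks_natr (R : pzSemiRingType) m (phi : seq nat -> nat) :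
  (walks m phi)%:R = walks m (fun s => (phi s)%:R) :> R.
Proof.
elim: m phi => [|m IH] phi //; rewrite !walksS IH; apply: eq_walks => s.
elim: s phi => [|b s IHs] phi //=.
by rewrite natrD (IHs (fun x => phi (b :: x))).
Qed.

(** * Cutting a walk at the last change of its bottom block *)

Section FirstBlock.
Variable R : comPzSemiRingType.
Implicit Types (phi : seq nat -> R) (psi : nat -> R).

Definition excursions m : R := walks m (at_empty R).

(** Sums [psi b] over the walks of length [m] that reach the single block [b] by a step modifying
    the bottom block: it is opened from the empty list, or its first arc closes and everything
    merges. The value 0 of [(sumn s).-1] covers both the empty list and the closing of a sole open
    arc. *)
Definition first_block m psi : R :=
  if m is m'.+1 then
    excursions m' * psi 1%N +
    walks m' (fun s => if (sumn s).-1 is k.+1 then psi k.+1 else 0)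
  else 0.

Lemma eq_first_block m psi1 psi2 :
  psi1 =1 psi2 -> first_block m psi1 = first_block m psi2.
Proof.
case: m => //= m E; rewrite E; congr (_ + _); apply: eq_walks => s.
by case: _.-1.
Qed.

Lemma first_blockD m psi1 psi2 :
  first_block m (fun b => psi1 b + psi2 b) =
  first_block m psi1 + first_block m psi2.
Proof.
case: m => [|m] /=; first by rewrite addr0.
rewrite mulrDr addrACA -walksD; congr (_ + _); apply: eq_walks => s.
by case: _.-1 => //; rewrite addr0.
Qed.

Lemma first_blockZ m c psi :
  first_block m (fun b => c * psi b) = c * first_block m psi.
Proof.
case: m => [|m] /=; first by rewrite mulr0.
rewrite mulrDr mulrCA -walksZ; congr (_ + _); apply: eq_walks => s.
by case: _.-1 => //; rewrite mulr0.
Qed.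

Lemma excursionsS m :
  excursions m.+1 =
  walks m (fun s => ((s != [::]) && ((sumn s).-1 == 0%N))%:R).
Proof.
rewrite /excursions walksS; apply: eq_walks => -[|b s] //=.
(* A step above the bottom block leaves that block in place and cannot reach the empty list. *)
rewrite (_ : succ_sum _ s = 0) ?add0r; last first.
  transitivity (succ_sum (fun _ => 0 : R) s); first exact: eq_succ_sum.
  by elim: s => //= c s ->; rewrite addr0.
by rewrite /at_empty; case: _.-1.
Qed.

(* The last time the bottom block is modified splits a walk ending in a
   nonempty state into a walk creating that block and a walk above it. *)
Lemma walks_first_block m phi :
  walks m phi = excursions m * phi [::] +
    \sum_(i < m.+1) first_block i (fun b => walks (m - i) (fun s => phi (b :: s))).
Proof.
elim: m phi => [|m IH] phi.
  by rewrite big_ord1 /= addr0 /excursions /walks /at_empty /= mul1r.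
(* In the induction a last step is added. It acts above the bottom block, or it closes the first arc
   of that block; [merged] evaluates [phi] after the second kind of step, which does not exist from
   the empty list. *)
pose merged s := if s is b :: s' then phi (block (sumn s).-1) else 0.
have Hm := IH merged; rewrite /= mulr0 add0r in Hm.
rewrite walksS IH /=.
under eq_bigr => i _.
  rewrite (@eq_first_block _ _ (fun b => walks (m.+1 - i) (fun s => phi (b :: s))
      + walks (m - i) (fun s => merged (b :: s)))); last first.
    by move=> b; rewrite subSn ?walksS -?walksD // -ltnS.
  rewrite first_blockD.
  over.
rewrite big_split /= -Hm [in RHS]big_ord_recr /= subnn excursionsS.
(* Such a step either empties the list and completes an excursion of length [m.+1], or leaves one
   block and supplies the second term of [first_block m.+1]. *)
have -> : walks m merged =
    walks m (fun s => ((s != [::]) && ((sumn s).-1 == 0%N))%:R) * phi [::] +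
    walks m (fun s => if (sumn s).-1 is k.+1 then phi [:: k.+1] else 0).
  rewrite mulrC -walksZ -walksD; apply: eq_walks => -[|b s] /=.
    by rewrite mulr0 addr0.
  by case: _.-1 => [|k] /=; rewrite ?mulr1 ?addr0 ?mulr0 ?add0r.
by rewrite addrCA [RHS]addrCA; congr (_ + _); rewrite addrCA.
Qed.

End FirstBlock.

(** * Reachable states and bounds on the number of walks *)

Lemma le_succ_sum (R : realDomainType) (phi psi : seq nat -> R) s :
  (forall x, all (leq 1) x ->
     sumn x = (sumn s).+1 \/ sumn s = (sumn x).+1 -> phi x <= psi x) ->
  all (leq 1) s -> succ_sum phi s <= succ_sum psi s.
Proof.
elim: s phi psi => [|b s IH] phi psi H /=; first by move=> _; apply: H => //; left.
case/andP=> b_gt0 s_gt0; apply: lerD.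
  apply: (IH (fun x => phi (b :: x)) (fun x => psi (b :: x))) => // x Hx xs.
  by apply: H => /=; rewrite ?b_gt0 //; lia.
apply: H; rewrite /= /block; case E: _.-1 => [|k] //=; lia.
Qed.

(** Each step opens or closes exactly one arc and creates no empty block, so only states with these
    properties are reachable. *)
Lemma le_walks (R : realDomainType) m (phi psi : seq nat -> R) :
  (forall x, all (leq 1) x -> (sumn x <= m)%N -> odd (sumn x) = odd m ->
     phi x <= psi x) ->
  walks m phi <= walks m psi.
Proof.
move=> H; rewrite /walks.
(* These three facts are the invariants, with the empty list generalized to any current state and
   the second [m] of each sum to the number of remaining steps. *)
have: all (leq 1) [::] by [].
have: odd (sumn [::] + m) = odd m by [].
have: (sumn [::] + m <= m)%N by [].
elim: {1 3 5 6}m [::] => [|k IH] s sm om s0 /=.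
  by rewrite addn0 in sm om; apply: H.
by apply: le_succ_sum => // x x0 xs; apply: IH => //; lia.
Qed.

Lemma walks_ge0 (R : realDomainType) m (phi : seq nat -> R) :
  (forall x, 0 <= phi x) -> 0 <= walks m phi.
Proof.
move=> H; rewrite -(mul0r (walks m phi)) -walksZ; apply: le_walks => x _ _ _.
by rewrite mul0r.
Qed.

Lemma eq_walks_reach (R : realDomainType) m (phi psi : seq nat -> R) :
  (forall x, all (leq 1) x -> (sumn x <= m)%N -> odd (sumn x) = odd m ->
     phi x = psi x) ->
  walks m phi = walks m psi.
Proof.
by move=> E; apply/eqP; rewrite eq_le; apply/andP; split; apply: le_walks => x *;
  rewrite E.
Qed.

(** The number of successors is unbounded, but the weight [2 ^+ size] grows at most fourfold:
    opening doubles it, and closing in the block of index [i] leaves at most [i.+1] blocks, which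
    sums geometrically. Hence there are at most [4 ^+ m] walks. *)
Lemma succ_sum_exp2_size (R : realDomainType) s :
  succ_sum (fun x => 2 ^+ size x) s <= 4 * 2 ^+ size s - 2 :> R.
Proof.
have Hb k : 2 ^+ size (block k) <= 2 :> R by case: k => [|k] /=; rewrite ?expr0 ?expr1 ?ler1n.
elim: s => [|b s IH] /=; first by rewrite expr1 expr0; lra.
rewrite (eq_succ_sum (psi := fun x => 2 * 2 ^+ size x)); last by move=> x; rewrite exprS.
rewrite succ_sumZ exprS; have := Hb (b + sumn s).-1; lra.
Qed.

Lemma walks_exp2_size (R : realDomainType) m :
  walks m (fun x => 2 ^+ size x) <= 4 ^+ m :> R.
Proof.
elim: m => [|m IH]; first by rewrite /walks /= !expr0.
rewrite walksS exprS; apply: le_trans (ler_wpM2l _ IH); last by rewrite ler0n.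
rewrite -walksZ; apply: le_walks => x _ _ _.
by apply: le_trans (succ_sum_exp2_size _ _) _; rewrite gerBl ler0n.
Qed.

(** * Polynomials counting walks by their open arcs *)

Section TotalSize.
Variable R : realDomainType.

(** The coefficient of t^m in the series U(v). *)
Definition total_poly m (v : R) : R := walks m (fun s => v ^+ sumn s).

Definition first_block_poly m (v : R) : R := first_block m (fun b => v ^+ b).

Lemma total_poly0r m : total_poly m 0 = excursions R m.
Proof.
apply: eq_walks_reach => -[|b s] //= /andP[b_gt0 _] _ _.
by rewrite expr0n /at_empty; case: b b_gt0.
Qed.

(** The exponent of [v] is additive over blocks, so the cut at the last change of the bottom block
    becomes U = F + A U, where A is the series of [first_block_poly]. *)
Lemma total_poly_first_block m v :
  total_poly m v = excursions R m +
    \sum_(i < m.+1) first_block_poly i v * total_poly (m - i) v.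
Proof.
rewrite /total_poly walks_first_block expr0 mulr1; congr (_ + _).
apply: eq_bigr => i _; rewrite mulrC -first_blockZ; apply: eq_first_block => b.
by rewrite mulrC -walksZ; apply: eq_walks => s; rewrite exprD.
Qed.

(** Closing in the bottom block lowers the exponent by one, which the factor [v] restores. States
    with no open arc, and those with one, which close to an excursion of length [m.+1], produce no
    block and are subtracted; the first term is the opening of the block. *)
Lemma first_block_polyS m v :
  v * first_block_poly m.+1 v =
  excursions R m * v ^+ 2 + (total_poly m v - excursions R m - v * excursions R m.+1).
Proof.
rewrite /first_block_poly /= mulrDr expr1 mulrCA -expr2; congr (_ + _).
rewrite excursionsS -!walksZ; apply/eqP; rewrite eq_sym 2!subr_eq; apply/eqP.
rewrite -!walksD; apply: eq_walks_reach => -[|b s] /=.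
  by rewrite /at_empty !mulr0 !add0r.
case/andP=> b_gt0 _ _ _; rewrite /at_empty /= addr0.
case E: _.-1 => [|k] /=; rewrite ?mulr1 ?mulr0 ?add0r ?addr0.
  by rewrite (_ : (b + sumn s = 1)%N) //; lia.
by rewrite -exprS; congr (_ ^+ _); lia.
Qed.

Lemma total_poly_ge0 m v : 0 <= v -> 0 <= total_poly m v.
Proof.
by move=> v0; apply: walks_ge0 => s; rewrite exprn_ge0.
Qed.

Lemma total_poly_le m v : 0 <= v <= 1 -> total_poly m v <= 4 ^+ m.
Proof.
case/andP=> v0 v1; apply: le_trans (walks_exp2_size R m); apply: le_walks => s _ _ _.
by apply: (le_trans (exprn_ile1 _ v0 v1)); rewrite exprn_ege1 // ler1n.
Qed.

Lemma excursions_ge0 m : 0 <= excursions R m.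
Proof. by rewrite -total_poly0r total_poly_ge0. Qed.

Lemma excursions_odd m : odd m -> excursions R m = 0.
Proof.
move=> om; rewrite -(mul0r (excursions R m)) -walksZ.
apply: eq_walks_reach => s _ _; rewrite om mul0r /at_empty.
by case: s.
Qed.

Lemma excursions0 : excursions R 0 = 1.
Proof. by []. Qed.

Lemma first_block_poly_ge0 m v : 0 <= v -> 0 <= first_block_poly m v.
Proof.
move=> v0; case: m => [|m] //; rewrite /first_block_poly /=.
apply: addr_ge0; first by rewrite mulr_ge0 ?excursions_ge0 ?exprn_ge0.
by apply: walks_ge0 => s; case: _.-1 => // k; rewrite exprn_ge0.
Qed.

(** At most [4 ^+ m] walks contribute, each with an exponent k at most [m], and w^k - v^k is at most
    k (w - v) on the unit interval. *)
Lemma total_poly_lipschitz m v w : 0 <= v <= w -> w <= 1 ->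
  0 <= total_poly m w - total_poly m v <= m%:R * 4 ^+ m * (w - v).
Proof.
case/andP=> v0 vw w1.
have E : total_poly m w = walks m (fun s => w ^+ sumn s - v ^+ sumn s) + total_poly m v.
  by rewrite -walksD; apply: eq_walks => s; rewrite subrK.
rewrite E addrK; apply/andP; split.
  apply: walks_ge0 => s.
  by rewrite subr_ge0 lerXn2r ?nnegrE // (le_trans v0).
rewrite -mulrA [4 ^+ _ * _]mulrC mulrA.
have wv : 0 <= w - v by rewrite subr_ge0.
apply: le_trans (ler_wpM2l _ (walks_exp2_size R m)); last first.
  by rewrite mulr_ge0 ?ler0n.
rewrite -walksZ; apply: le_walks => s _ sm _.
have H k : w ^+ k - v ^+ k <= k%:R * (w - v).
  rewrite subrXX mulrC; apply: ler_wpM2r => //.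
  rewrite -[k in leRHS]card_ord -sum1_card natr_sum; apply: ler_sum => i _.
  have w0 := le_trans v0 vw.
  by rewrite mulr_ile1 ?exprn_ge0 ?exprn_ile1 // (le_trans vw).
apply: (le_trans (H _)); rewrite -[leLHS]mulr1.
apply: ler_pM; rewrite ?mulr_ge0 ?ler0n ?ler01 //; last by rewrite exprn_ege1 // ler1n.
by rewrite ler_wpM2r // ler_nat.
Qed.

End TotalSize.

(** * Matchings as walks *)

Local Open Scope nat_scope.

Lemma succ_sumE (V : nmodType) (phi : seq nat -> V) s :
  (succ_sum phi s = phi (rcons s 1%N) + \sum_(i < size s)
    phi (take i s ++ block (nth 0%N s i + sumn (drop i.+1 s)).-1))%R.
Proof.
elim: s phi => [|b s IH] phi /=; first by rewrite big_ord0 addr0.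
rewrite (IH (fun x => phi (b :: x))) big_ord_recl /= drop0 -addrA.
by congr (_ + _)%R; rewrite addrC.
Qed.

(** * Counting the completions of a partly read matching *)

Section Completions.
Variable N : nat.
Implicit Types (f : {ffun 'I_N -> 'I_N}) (bs pre post : seq (seq 'I_N)).
Implicit Types (B : seq 'I_N) (p : nat) (a b c x z : 'I_N).

(* [f] pairs up the points that are either open arcs, listed block by block in
   [bs], or not yet read, that is at least [p]; the points already paired are
   fixed. Two arcs opened in the same block close in the order of opening. *)
Definition completion bs p f : bool :=
  [&& [forall x, f (f x) == x],
      [forall x, (f x != x) == ((x \in flatten bs) || (p <= x))],
      [forall x, (x \in flatten bs) ==> (p <= f x)],
      [forall a : 'I_N, forall b : 'I_N, forall c : 'I_N,
         ~~ [&& a < b, b < c, c < f a, f a < f c & f c < f b]] &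
      all (fun B => [forall a : 'I_N, forall b : 'I_N,
         [&& a \in B, b \in B & a < b] ==> (f a < f b)]) bs].

Record completion_spec bs p f : Prop := CompletionSpec {
  compl_inv : forall x, f (f x) = x;
  compl_fix : forall x, f x <> x <-> (x \in flatten bs) || (p <= x);
  compl_open : forall x, x \in flatten bs -> p <= f x;
  compl_avoid : forall a b c, a < b -> b < c -> c < f a -> f a < f c -> f c < f b -> False;
  compl_fifo : forall B, B \in bs -> forall a b, a \in B -> b \in B -> a < b -> f a < f b
}.

Lemma completionP bs p f : reflect (completion_spec bs p f) (completion bs p f).
Proof.
apply: (iffP and5P) => [[/forallP H1 /forallP H2 /forallP H3 /forallP H4 /allP H5]|].
  split=> [x|x|x xb|a b c ab bc ca fac fcb|B Bb a b aB bB ab].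
  - exact/eqP.
  - by rewrite -(eqP (H2 x)); split=> [/eqP|/eqP].
  - by have /implyP := H3 x; apply.
  - by have /forallP/(_ b)/forallP/(_ c)/negP := H4 a; apply; apply/and5P.
  - by have /forallP/(_ a)/forallP/(_ b)/implyP := H5 B Bb; apply; apply/and3P.
case=> H1 H2 H3 H4 H5; split.
- by apply/forallP => x; apply/eqP.
- by apply/forallP => x; apply/eqP; apply/idP/idP => [/eqP/H2|/H2/eqP].
- by apply/forallP => x; apply/implyP; apply: H3.
- apply/forallP => a; apply/forallP => b; apply/forallP => c.
  by apply/negP => /and5P[? ? ? ? ?]; apply: (H4 a b c).
- apply/allP => B Bb; apply/forallP => a; apply/forallP => b.
  by apply/implyP => /and3P[]; apply: H5.
Qed.

Definition completions bs p : {set {ffun 'I_N -> 'I_N}} :=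
  [set f | completion bs p f].

Definition valid_state bs p : Prop :=
  [/\ sorted ltn (map val (flatten bs)), all (fun x : 'I_N => x < p) (flatten bs)
    & all (fun B => B != [::]) bs].

Definition close_block (B : seq 'I_N) : seq (seq 'I_N) :=
  if B is [::] then [::] else [:: B].

Lemma flatten_close_block B : flatten (close_block B) = B.
Proof. by case: B => //= x B; rewrite cats0. Qed.

Lemma size_close_block B : map size (close_block B) = block (size B).
Proof. by case: B. Qed.

Lemma valid_state_split pre x B post p :
  valid_state (pre ++ (x :: B) :: post) p ->
  [/\ forall z, z \in flatten pre -> z < x,
      forall z, z \in B ++ flatten post -> x < z & x < p].
Proof.
case; rewrite !flatten_cat /= map_cat /= => so al _; split.
- move=> z zp; move: so; rewrite sorted_pairwise; last exact: ltn_trans.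
  rewrite pairwise_cat => /and3P[/allrelP H _ _].
  by apply: H; rewrite ?mem_head // map_f.
- move=> z zp; move: so; rewrite sorted_pairwise; last exact: ltn_trans.
  rewrite pairwise_cat => /and3P[_ _] /= /andP[/allP H _].
  by apply: H; rewrite map_f.
- by move: al; rewrite all_cat /= => /and3P[].
Qed.

Lemma valid_state_close pre x B post p :
  valid_state (pre ++ (x :: B) :: post) p ->
  valid_state (pre ++ close_block (B ++ flatten post)) p.+1.
Proof.
case=> so al ne; split.
- apply: subseq_sorted so; first exact: ltn_trans.
  apply: map_subseq; rewrite !flatten_cat flatten_close_block /=.
  by rewrite cat_subseq // -cat1s suffix_subseq.
- have /allP H := al; apply/allP => z; rewrite flatten_cat flatten_close_block => zs.
  apply: ltnW; apply: H; rewrite !flatten_cat /= !mem_cat inE mem_cat.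
  by move: zs; rewrite !mem_cat; case/or3P=> ->; rewrite ?orbT.
- by move: ne; rewrite !all_cat /= => /andP[-> _]; case: (B ++ _).
Qed.

Definition add_arc x z f := [ffun y => if y == x then z else if y == z then x else f y].

(** Deleting the arc [(x, q)] is a bijection. Two arcs opened after [x] and still open at [q] cannot
    close in reverse order without forming 312 with [(x, q)]; this is exactly the first in, first
    out condition on the merged block. *)
Lemma close_completions pre x B post p (q : 'I_N) : val q = p ->
  valid_state (pre ++ (x :: B) :: post) p ->
  #|[set f in completions (pre ++ (x :: B) :: post) p | f q == x]| =
  #|completions (pre ++ close_block (B ++ flatten post)) p.+1|.
Proof.
move=> Eq st; have [preL postG xp] := valid_state_split st.
case: st => so al ne.
set bs := pre ++ _ :: post; set bs' := pre ++ close_block _.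
have mem' z : (z \in flatten bs') = (z \in flatten pre) || (z \in B ++ flatten post).
  by rewrite /bs' flatten_cat flatten_close_block mem_cat.
have mem z : (z \in flatten bs) = (z == x) || (z \in flatten bs').
  rewrite mem' /bs flatten_cat mem_cat /= inE; case: (z == x); rewrite ?orbT //.
have xq : (x == q) = false by apply/negP => /eqP E; move: xp; rewrite E Eq ltnn.
have ltp z : z \in flatten bs -> z < p by move=> zb; exact: (allP al).
have xnot : x \notin flatten bs'.
  rewrite mem'; apply/negP => /orP[/preL|/postG]; by rewrite ltnn.
have qnot : q \notin flatten bs'.
  by apply/negP => H; have := ltp q; rewrite mem H orbT Eq ltnn => /(_ isT).
have fx' f z : completion_spec bs' p.+1 f -> (z == x) || (z == q) -> f z = z.
  move=> C zxq; apply/eqP; apply: contraT => /eqP /(compl_fix C).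
  case/orP: zxq => /eqP ->; rewrite ?(negbTE xnot) ?(negbTE qnot) /=.
    by rewrite ltnNge (ltnW xp).
  by rewrite Eq ltnn.
have add_arcE f : completion_spec bs' p.+1 f -> forall z, (z == x) = false -> (z == q) = false ->
    [/\ add_arc x q f z = f z, (f z == x) = false & (f z == q) = false].
  move=> C z zx zq; rewrite ffunE zx zq; split=> //; apply/negP => /eqP E.
    by move: zx; rewrite -(compl_inv C z) E (fx' f x C) ?eqxx.
  by move: zq; rewrite -(compl_inv C z) E (fx' f q C) ?eqxx ?orbT.
have add_arcx f : add_arc x q f x = q by rewrite ffunE eqxx.
have add_arcq f : add_arc x q f q = x by rewrite ffunE eq_sym xq eqxx.
(* Completions of the merged state fix [x] and [q], so inserting the arc loses no information. *)
rewrite -[RHS](@card_in_imset _ _ (add_arc x q)); last first.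
  move=> f g /[!inE] /completionP Cf /completionP Cg /ffunP E; apply/ffunP => z.
  have := E z; rewrite !ffunE; case: eqP => [->|_].
    by rewrite !(fx' _ x) ?eqxx.
  by case: eqP => [->|//]; rewrite !(fx' _ q) ?eqxx ?orbT.
apply: eq_card => f; rewrite !inE; apply/andP/imsetP; last first.
  case=> g /[!inE] /completionP Cg ->; split; last by rewrite add_arcq.
  have L := add_arcE g Cg.
  have opn z : (z == x) = false -> z < p -> z < add_arc x q g z ->
      z \in flatten bs' /\ p < add_arc x q g z.
    move=> zx zp; have zq : (z == q) = false by apply/negP => /eqP E; move: zp; rewrite E Eq ltnn.
    have [-> _ _] := L z zx zq => zg.
    have zb : z \in flatten bs'.
      have /(compl_fix Cg) : g z <> z by move=> E; rewrite E ltnn in zg.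
      by case/orP=> //; rewrite ltnNge (ltnW zp).
    by split=> //; apply: (compl_open Cg).
  apply/completionP; split.
  - move=> z; case: (eqVneq z x) => [->|/negbTE zx]; first by rewrite add_arcx add_arcq.
    case: (eqVneq z q) => [->|/negbTE zq]; first by rewrite add_arcq add_arcx.
    have [-> gx gq] := L z zx zq; have [-> _ _] := L _ gx gq; exact: (compl_inv Cg).
  - move=> z; rewrite mem; case: (eqVneq z x) => [->|/negbTE zx].
      by rewrite add_arcx /=; split=> // _ E; rewrite E eqxx in xq.
    case: (eqVneq z q) => [->|/negbTE zq].
      by rewrite add_arcq /= Eq leqnn orbT; split=> // _ E; rewrite E eqxx in xq.
    have [-> _ _] := L z zx zq; rewrite (compl_fix Cg) /= [p <= _]leq_eqVlt.
    rewrite (_ : (p == z) = false) //; apply/negP => /eqP E.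
    by move/negP: zq; apply; apply/eqP/val_inj; rewrite /= -E Eq.
  - move=> z; rewrite mem; case: (eqVneq z x) => [->|/negbTE zx] /=; first by rewrite add_arcx Eq.
    move=> zb; have zq : (z == q) = false by apply/negP => /eqP E; rewrite E (negbTE qnot) in zb.
    have [-> _ _] := L z zx zq; apply: ltnW; exact: (compl_open Cg).
  - move=> a b c ab bc ca ac cb.
    have nq z : z < add_arc x q g z -> (z == q) = false.
      by move=> H; apply/negP => /eqP E; move: H; rewrite E add_arcq Eq ltnNge (ltnW xp).
    have aq := nq a (ltn_trans ab (ltn_trans bc ca)).
    have bq := nq b (ltn_trans bc (ltn_trans ca (ltn_trans ac cb))).
    have cq := nq c (ltn_trans ca ac).
    (* If [(x, q)] is the first arc of an occurrence, the other two were opened after [x] and lie in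
       the merged block, whose closing order contradicts the occurrence. *)
    case: (eqVneq a x) => [ax|/negbTE ax].
      move: ca ac; rewrite ax add_arcx Eq => cp pc.
      have bx : (b == x) = false by apply/negP => /eqP E; rewrite ax E ltnn in ab.
      have cx : (c == x) = false.
        by apply/negP => /eqP E; move: (ltn_trans ab bc); rewrite ax E ltnn.
      have [bb _] : b \in flatten bs' /\ p < add_arc x q g b.
        apply: opn => //; first exact: ltn_trans bc cp.
        exact: ltn_trans (ltn_trans bc cp) (ltn_trans pc cb).
      have [cb' _] : c \in flatten bs' /\ p < add_arc x q g c.
        by apply: opn => //; exact: ltn_trans cp pc.
      have inpost z : x < z -> z \in flatten bs' -> z \in B ++ flatten post.
        by rewrite mem' => xz /orP[/preL|//] /(ltn_trans xz); rewrite ltnn.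
      rewrite ax in ab.
      have bpost := inpost b ab bb; have cpost := inpost c (ltn_trans ab bc) cb'.
      have Bin : B ++ flatten post \in bs'.
        by rewrite /bs' mem_cat; case: (B ++ _) bpost => //= y s _; rewrite inE eqxx orbT.
      have := compl_fifo Cg Bin bpost cpost bc.
      have [<- _ _] := L b bx bq; have [<- _ _] := L c cx cq.
      by move/(ltn_trans cb); rewrite ltnn.
    (* If [(x, q)] is the second or third arc, the first one is open at [p] and closes after it,
       whereas the pattern makes it close before [q]. *)
    case: (eqVneq b x) => [bxe|/negbTE bx].
      rewrite bxe add_arcx Eq in ab bc cb.
      have [_ pa] := opn a ax (ltn_trans ab xp) (ltn_trans ab (ltn_trans bc ca)).
      by have := ltn_trans pa (ltn_trans ac cb); rewrite ltnn.
    case: (eqVneq c x) => [cxe|/negbTE cx].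
      rewrite cxe add_arcx Eq in bc cb ca ac; have ax' := ltn_trans ab bc.
      have [_ pa] := opn a ax (ltn_trans ax' xp) (ltn_trans ax' ca).
      by have := ltn_trans pa ac; rewrite ltnn.
    move: ca ac cb; have [-> _ _] := L a ax aq; have [-> _ _] := L b bx bq.
    by have [-> _ _] := L c cx cq; apply: (compl_avoid Cg).
  - move=> A Ab a b aA bA ab.
    have inA z : z \in A -> z \in flatten bs by move=> zA; apply/flattenP; exists A.
    have nq z : z \in A -> (z == q) = false.
      by move=> zA; apply/negP => /eqP E; move: (ltp z (inA _ zA)); rewrite E Eq ltnn.
    have [aq bq] := (nq a aA, nq b bA).
    have gp z : z \in A -> (z == x) = false -> p < add_arc x q g z.
      move=> zA zx; have [-> _ _] := L z zx (nq z zA).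
      by apply: (compl_open Cg); move: (inA z zA); rewrite mem zx.
    (* The old block and the later ones inherit their order from the merged block, and [x] closes
       before all of them, at [q]. *)
    have post_fifo : {subset A <= x :: B ++ flatten post} -> add_arc x q g a < add_arc x q g b.
      move=> sub; have := sub _ bA; have := sub _ aA; rewrite !in_cons.
      case: (eqVneq b x) => [bx|/negbTE bx] /=.
        move: ab; rewrite bx => ax /orP[/eqP E|/postG]; last by move/(ltn_trans ax); rewrite ltnn.
        by rewrite E ltnn in ax.
      case: (eqVneq a x) => [ax|/negbTE ax] /=; first by rewrite {1}ax add_arcx Eq => _ _; apply: gp.
      have [-> _ _] := L a ax aq; have [-> _ _] := L b bx bq => aB bB.
      apply: (compl_fifo Cg (B := B ++ flatten post)) => //.
      by rewrite /bs' mem_cat; case: (B ++ _) aB => //= y s _; rewrite inE eqxx orbT.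
    move: (Ab); rewrite /bs mem_cat inE => /or3P[Apre|/eqP AE|Apost].
    + have nx z : z \in A -> (z == x) = false.
        move=> zA; apply/negP => /eqP E; have : z \in flatten pre by apply/flattenP; exists A.
        by move/preL; rewrite E ltnn.
      have [-> _ _] := L a (nx a aA) aq; have [-> _ _] := L b (nx b bA) bq.
      by apply: (compl_fifo Cg (B := A)); rewrite // /bs' mem_cat Apre.
    + by apply: post_fifo => z; rewrite AE !inE mem_cat => /orP[->|->]; rewrite ?orbT.
    + apply: post_fifo => z zA; rewrite inE mem_cat; apply/or3P; apply: Or33.
      by apply/flattenP; exists A.
(* Conversely, a completion closing [x] at [q] arises from the one in which both points are made
   fixed. *)
case=> /completionP C /eqP fq.
have fxq : f x = q by rewrite -fq (compl_inv C).
exists [ffun z => if (z == x) || (z == q) then z else f z]; last first.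
  apply/ffunP => z; rewrite !ffunE; case: eqP => [->//|_]; case: eqP => [->//|_] //.
set g := finfun _.
have gE z : (z == x) = false -> (z == q) = false ->
    [/\ g z = f z, (f z == x) = false & (f z == q) = false].
  move=> zx zq; rewrite ffunE zx zq; split=> //; apply/negP => /eqP E.
    by move: zq; rewrite -(compl_inv C z) E fxq eqxx.
  by move: zx; rewrite -(compl_inv C z) E fq eqxx.
have gx : g x = x by rewrite ffunE eqxx.
have gq : g q = q by rewrite ffunE eqxx orbT.
have ne' z : z < g z -> [/\ (z == x) = false, (z == q) = false & g z = f z].
  rewrite ffunE; case: (z == x) => /=; first by rewrite ltnn.
  by case: (z == q) => //; rewrite ltnn.
have inb' z : z \in flatten bs' -> [/\ (z == x) = false, (z == q) = false, g z = f z & p < f z].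
  move=> zb; have zx : (z == x) = false by apply/negP => /eqP E; rewrite E (negbTE xnot) in zb.
  have zq : (z == q) = false by apply/negP => /eqP E; rewrite E (negbTE qnot) in zb.
  have [-> _ fzq] := gE z zx zq; split=> //.
  have := compl_open C (x := z); rewrite mem zb orbT => /(_ isT).
  rewrite leq_eqVlt => /orP[/eqP E|//]; move/negP: fzq; case.
  by apply/eqP/val_inj; rewrite /= -E Eq.
rewrite inE; apply/completionP; split.
- move=> z; case: (eqVneq z x) => [->|/negbTE zx]; first by rewrite !gx.
  case: (eqVneq z q) => [->|/negbTE zq]; first by rewrite !gq.
  have [-> fzx fzq] := gE z zx zq; have [-> _ _] := gE _ fzx fzq; exact: (compl_inv C).
- move=> z; case: (eqVneq z x) => [->|/negbTE zx].
    by rewrite gx (negbTE xnot) /= ltnNge (ltnW xp).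
  case: (eqVneq z q) => [->|/negbTE zq].
    by rewrite gq (negbTE qnot) /= Eq ltnn.
  have [-> _ _] := gE z zx zq; rewrite (compl_fix C) mem zx /= [p <= _]leq_eqVlt.
  rewrite (_ : (p == z) = false) //; apply/negP => /eqP E.
    by move/negP: zq; apply; apply/eqP/val_inj; rewrite /= -E Eq.
- by move=> z /inb'[_ _ -> ].
- move=> a b c ab bc ca ac cb.
  have [_ _ E1] := ne' a (ltn_trans ab (ltn_trans bc ca)).
  have [_ _ E2] := ne' b (ltn_trans bc (ltn_trans ca (ltn_trans ac cb))).
  have [_ _ E3] := ne' c (ltn_trans ca ac).
  by apply: (compl_avoid C ab bc); rewrite -?E1 -?E2 -?E3.
- move=> A; rewrite /bs' mem_cat => /orP[Apre|Apost] a b aA bA ab.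
    have inA z : z \in A -> z \in flatten bs'.
      by move=> zA; rewrite mem'; apply/orP; left; apply/flattenP; exists A.
    have [_ _ -> _] := inb' a (inA a aA); have [_ _ -> _] := inb' b (inA b bA).
    by apply: (compl_fifo C (B := A)); rewrite // /bs mem_cat Apre.
  have AE : A = B ++ flatten post.
    by move: Apost; case: (B ++ _) => //= y s; rewrite inE => /eqP.
  have inA z : z \in A -> z \in flatten bs' by move=> zA; rewrite mem' -AE zA orbT.
  have [ax _ -> pa] := inb' a (inA a aA); have [bx _ -> pb] := inb' b (inA b bA).
  (* The reverse closing order of [a] and [b] would form 312 with the arc [(x, q)]. *)
  rewrite ltnNge leq_eqVlt; apply/negP => /orP[/eqP/val_inj E|fba].
    by move: ab; rewrite -(compl_inv C a) -E (compl_inv C) ltnn.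
  have bp : b < p by apply: ltp; rewrite mem inA ?orbT.
  by apply: (compl_avoid C (a := x) (b := a) (c := b)); rewrite ?fxq ?Eq // postG // -AE.
Qed.

(** The closing order within a singleton block is vacuous, so an opening at [q] only changes what
    counts as open. *)
Lemma open_completions bs p (q : 'I_N) : val q = p -> valid_state bs p ->
  [set f in completions bs p | q < f q] = completions (rcons bs [:: q]) p.+1.
Proof.
move=> Eq [so al ne].
have mem z : (z \in flatten (rcons bs [:: q])) = (z \in flatten bs) || (z == q).
  by rewrite flatten_rcons mem_cat inE.
have ltp z : z \in flatten bs -> z < p by move=> zb; exact: (allP al).
apply/setP => f; rewrite !inE; apply/andP/idP => [[/completionP C qf]|/completionP C].
  apply/completionP; split.
  - exact: (compl_inv C).
  - move=> z; rewrite mem (compl_fix C) -orbA; case: (z \in _) => //=.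
    by rewrite leq_eqVlt -Eq [q == z :> nat]eq_sym.
  - move=> z; rewrite mem => /orP[zb|/eqP ->]; last by rewrite -Eq.
    rewrite ltn_neqAle (compl_open C zb) andbT -Eq; apply/negP => /eqP/val_inj E.
    have := ltp z zb; rewrite -(compl_inv C z) -E -Eq.
    by move=> /(ltn_trans qf); rewrite ltnn.
  - exact: (compl_avoid C).
  - move=> A; rewrite mem_rcons inE => /orP[/eqP ->|/(compl_fifo C)//] a b.
    by rewrite !inE => /eqP -> /eqP ->; rewrite ltnn.
have qf : q < f q by rewrite Eq (compl_open C) // mem eqxx orbT.
split=> //; apply/completionP; split.
- exact: (compl_inv C).
- move=> z; rewrite (compl_fix C) mem -orbA; case: (z \in _) => //=.
  by rewrite [p <= z]leq_eqVlt -Eq [q == z :> nat]eq_sym.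
- by move=> z zb; apply: ltnW; apply: (compl_open C); rewrite mem zb.
- exact: (compl_avoid C).
- by move=> A Ab; apply: (compl_fifo C); rewrite mem_rcons inE Ab orbT.
Qed.

Lemma valid_state_open bs p (q : 'I_N) : val q = p -> valid_state bs p ->
  valid_state (rcons bs [:: q]) p.+1.
Proof.
move=> Eq [so al ne]; split.
- rewrite flatten_rcons map_cat /= cats1 sorted_pairwise; last exact: ltn_trans.
  rewrite -cats1 pairwise_cat /= andbT -sorted_pairwise ?so ?andbT; last exact: ltn_trans.
  by rewrite allrel1r all_map; apply: sub_all al => z; rewrite /= Eq.
- rewrite flatten_rcons all_cat /= Eq ltnSn /= andbT.
  by apply: sub_all al => z; apply: ltnW.
- by rewrite all_rcons.
Qed.

(** The next point opens an arc or closes an open one, and within a block only the first arc may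
    close. *)
Lemma card_close_open bs p (q : 'I_N) : val q = p -> valid_state bs p ->
  #|completions bs p| = #|[set f in completions bs p | q < f q]| +
    \sum_(i < size bs)
      #|[set f in completions bs p | f q == head q (nth [::] bs i)]|.
Proof.
move=> Eq [so al ne].
have ltp z : z \in flatten bs -> z < p by move=> zb; exact: (allP al).
pose hs := map (head q) bs.
have hsub : subseq hs (flatten bs).
  rewrite /hs; elim: (bs) ne => //= -[//|y B] cs IH /= /IH csub; rewrite eqxx.
  exact: subseq_trans csub (suffix_subseq _ _).
have uhs : uniq hs.
  apply: subseq_uniq hsub _; rewrite -(map_inj_uniq val_inj).
  by apply: (sorted_uniq _ _ so) => [? ? ?|?]; [exact: ltn_trans|rewrite /= ltnn].
have cardE (P : pred {ffun 'I_N -> 'I_N}) :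
    #|[set f in completions bs p | P f]| = \sum_(f in completions bs p) P f.
  by rewrite -sum1_card [RHS]big_mkcond [LHS]big_mkcond /=; apply: eq_bigr => f _; rewrite !inE;
    case: (completion _ _ _) => //=; case: (P f).
under eq_bigr => i _ do rewrite (cardE (fun f => f q == head q (nth [::] bs i))).
rewrite (cardE (fun f => q < f q)).
rewrite exchange_big -big_split -sum1_card; apply: eq_bigr => f /[!inE] /completionP C /=.
(* The heads of the blocks are distinct, so a completion is counted at most once. *)
have -> : \sum_(i < size bs) (f q == head q (nth [::] bs i)) = (f q \in hs).
  rewrite -(count_uniq_mem _ uhs) /hs.
  rewrite -(big_mkord xpredT (fun i => (f q == head q (nth [::] bs i) : nat))).
  rewrite -(big_nth [::] xpredT (fun B => (f q == head q B : nat))).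
  elim: (bs) => [|B cs IH]; rewrite ?big_nil // big_cons IH /= eq_sym.
  by [].
case: ltnP => qf.
  rewrite (_ : (f q \in hs) = false) //; apply/negP => /(mem_subseq hsub)/ltp.
  by rewrite -Eq ltnNge (ltnW qf).
have fqq : f q <> q by apply/(compl_fix C); rewrite Eq leqnn orbT.
have fqp : f q < p.
  rewrite -Eq ltn_neqAle qf andbT; apply/negP => /eqP/val_inj; exact: fqq.
have: f (f q) <> f q by rewrite (compl_inv C); apply: nesym.
move/(compl_fix C); rewrite leqNgt fqp orbF => /flattenP[B Bb fB].
suff -> : f q \in hs by [].
apply/mapP; exists B => //.
(* Were [f q] not the head [y] of its block, [y] would have to close before [q], although no open
   arc closes before [p]. *)
case: B fB Bb => [|y B] //=; rewrite inE => /predU1P[//|fB] Bb.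
have yb : y \in flatten bs by apply/flattenP; exists (y :: B); rewrite ?mem_head.
have [pre [post bsE]] : exists pre post, bs = pre ++ (y :: B) :: post.
  by case/splitPr: (Bb) => pre post; exists pre, post.
move: so; rewrite bsE flatten_cat map_cat /= sorted_pairwise; last exact: ltn_trans.
rewrite pairwise_cat => /and3P[_ _] /= /andP[/allP H _].
have yf : y < f q by apply: H; rewrite map_f // mem_cat fB.
have := compl_fifo C Bb (mem_head _ _) (_ : f q \in y :: B) yf.
rewrite inE fB orbT (compl_inv C) => /(_ isT).
by rewrite Eq ltnNge (compl_open C yb).
Qed.

(** Each of the [k] unread points is one step of a walk, and the counts above depend on the blocks
    only through their sizes. When nothing is left to read, the identity is the only completion, and
    it requires that no arc be open. *)
Lemma card_completions k bs p : p + k = N -> valid_state bs p ->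
  #|completions bs p| = iter k (@succ_sum nat) (fun s => (s == [::]) : nat) (map size bs).
Proof.
elim: k bs p => [|k IH] bs p pN st.
  rewrite addn0 in pN; case: bs st => [|B bs] st /=.
    rewrite -(cards1 [ffun x : 'I_N => x]); apply: eq_card => f; rewrite !inE.
    apply/completionP/eqP => [C|->].
      apply/ffunP => x; rewrite ffunE; apply/eqP; apply: contraT => /eqP/(compl_fix C).
      by rewrite /= pN leqNgt ltn_ord.
    split=> //= x; rewrite ?ffunE //; first by rewrite pN leqNgt ltn_ord.
    by move=> b c; rewrite !ffunE => /ltn_trans H /H /ltn_trans/[apply]; rewrite ltnn.
  case: st => _ _ /=; case: B => // x B _.
  apply: eq_card0 => f; rewrite inE; apply/completionP => C.
  have : x \in flatten ((x :: B) :: bs) by rewrite mem_head.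
  by move/(compl_open C); rewrite pN leqNgt ltn_ord.
have lt_pN : p < N by lia.
pose q := Ordinal lt_pN.
rewrite (card_close_open (q := q)) // open_completions // (IH _ p.+1) ?addSnnS //; last first.
  exact: valid_state_open.
rewrite iterS succ_sumE map_rcons size_map; congr (_ + _)%R.
apply: eq_bigr => i _.
have bsE : bs = take i bs ++ nth [::] bs i :: drop i.+1 bs.
  by rewrite -drop_nth ?ltn_ord // cat_take_drop.
have: nth [::] bs i != [::] by case: st => _ _ /allP; apply; rewrite mem_nth ?ltn_ord.
case Bi: (nth [::] bs i) => [//|x B] _ /=; rewrite Bi in bsE.
rewrite -map_take (nth_map [::]) ?ltn_ord // Bi -map_drop /=.
rewrite {1}bsE close_completions // -?bsE //.
rewrite (IH _ p.+1) ?addSnnS //; last by apply: (@valid_state_close _ x); rewrite -bsE.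
by rewrite map_cat size_close_block size_cat size_flatten.
Qed.

End Completions.

(** * Perfect matchings as fixed-point-free involutions *)

Section Arcs.
Variable n : nat.
Implicit Types (f g : {ffun 'I_(2 * n) -> 'I_(2 * n)}) (M : {set 'I_(2 * n) * 'I_(2 * n)}).

Definition arcs f : {set 'I_(2 * n) * 'I_(2 * n)} :=
  [set p : 'I_(2 * n) * 'I_(2 * n) | (p.1 < p.2) && (f p.1 == p.2)].

Lemma mem_arcs f x y : ((x, y) \in arcs f) = (x < y) && (f x == y).
Proof. by rewrite inE. Qed.

Lemma perfect_matching_arcs f :
  (forall x, f (f x) = x) -> (forall x, f x <> x) -> perfect_matching (arcs f).
Proof.
move=> ff fne.
have lt_f x : (f x < x) = ~~ (x < f x).
  rewrite -leqNgt [f x <= x]leq_eqVlt orbC (_ : (f x == x :> nat) = false) ?orbF //.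
  by apply/eqP => /val_inj /fne.
apply/and4P; split.
(* The involution exchanges the openers [A] with their complement, so there are [n] openers and as
   many arcs. *)
- pose A := [set x : 'I_(2 * n) | x < f x].
  have inj_f : injective f by move=> x y E; rewrite -(ff x) E ff.
  have fA : f @: A = ~: A.
    apply/setP => y; rewrite !inE -lt_f; apply/imsetP/idP => [[x]|yf].
      by rewrite inE => xf ->; rewrite ff.
    by exists (f y); rewrite ?inE ff.
  have := cardsC A; rewrite -fA card_imset // card_ord => EA.
  suff -> : arcs f = [set (x, f x) | x in A] by rewrite card_imset => [|x y []//]; lia.
  apply/setP => -[x y]; rewrite mem_arcs; apply/andP/imsetP => [[xy /eqP E]|[z]].
    by exists x; rewrite ?inE E.
  by rewrite inE => zf [-> ->].
- by apply/forall_inP => -[x y]; rewrite mem_arcs => /andP[].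
- apply/forall_inP => -[x y] xyM; apply/forall_inP => -[x' y'] xyM'.
  move: xyM xyM'; rewrite !mem_arcs => /andP[xy /eqP fx] /andP[xy' /eqP fx'].
  apply/implyP => ne; rewrite -setI_eq0; apply/eqP/setP => z; rewrite !inE /=.
  apply/negP; move=> /andP[/orP[]/eqP ? /orP[]/eqP ?]; subst.
  + by rewrite eqxx in ne.
  + by move: xy; rewrite ff => /(ltn_trans xy'); rewrite ltnn.
  + by move: xy'; rewrite ff => /(ltn_trans xy); rewrite ltnn.
  + by move: ne; rewrite (_ : x = x') ?eqxx //; rewrite -(ff x) -(ff x'); congr (f _).
apply/eqP/setP => x; rewrite inE; apply/bigcupP.
case: (ltnP x (f x)) => [xf|].
  by exists (x, f x); rewrite ?mem_arcs ?xf ?eqxx // !inE eqxx.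
rewrite leqNgt -lt_f => fx; exists (f x, x); last by rewrite !inE eqxx orbT.
by rewrite mem_arcs ff eqxx fx.
Qed.

Lemma arcs_inj f g : (forall x, f (f x) = x) -> (forall x, g (g x) = x) ->
  (forall x, f x <> x) -> arcs f = arcs g -> f = g.
Proof.
move=> ff gg fne E; apply/ffunP => x.
case: (ltngtP x (f x)) => [xf|fx|/val_inj/esym/fne//].
  have : (x, f x) \in arcs g by rewrite -E mem_arcs xf eqxx.
  by rewrite mem_arcs => /andP[_ /eqP].
have : (f x, x) \in arcs g by rewrite -E mem_arcs fx ff eqxx.
by rewrite mem_arcs => /andP[_ /eqP gfx]; rewrite -{2}gfx gg.
Qed.

Lemma perfect_matchingP M : perfect_matching M ->
  exists f, [/\ forall x, f (f x) = x, forall x, f x <> x & M = arcs f].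
Proof.
case/and4P=> _ /forall_inP lt_M /forall_inP dis /eqP cov.
pose partner x (p : 'I_(2 * n) * 'I_(2 * n)) := if x == p.1 then p.2 else p.1.
(* Disjointness makes the picked arc unique, and the default value never occurs because the arcs
   cover all points. *)
pose f := [ffun x => if [pick p in M | x \in ends p] is Some p then partner x p else x].
have fE x p : p \in M -> x \in ends p -> f x = partner x p.
  move=> pM xp; rewrite ffunE; case: pickP => [r /andP[rM xr]|/(_ p)]; last by rewrite pM xp.
  case: (eqVneq p r) => [->//|ne].
  have /forall_inP/(_ r rM)/implyP/(_ ne) := dis p pM.
  by rewrite -setI_eq0 => /eqP/setP/(_ x); rewrite inE xp xr inE.
have f1 p : p \in M -> f p.1 = p.2.
  by move=> pM; rewrite (fE _ p) ?inE ?eqxx // /partner eqxx.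
have f2 p : p \in M -> f p.2 = p.1.
  move=> pM; have ne : (p.2 == p.1) = false.
    by apply/negP => /eqP E; have := lt_M p pM; rewrite E ltnn.
  by rewrite (fE _ p) ?inE ?eqxx ?orbT // /partner ne.
have ex x : exists2 p, p \in M & (x = p.1) \/ (x = p.2).
  have : x \in \bigcup_(p in M) ends p by rewrite cov inE.
  by case/bigcupP=> p pM; rewrite !inE => /orP[]/eqP; exists p; auto.
exists f; split.
- by move=> x; have [p pM [->|->]] := ex x; rewrite ?f1 // ?f2 ?f1.
- move=> x; have [p pM [->|->]] := ex x; rewrite ?f1 ?f2 // => E;
  by have := lt_M p pM; rewrite E ltnn.
apply/setP => -[x y]; rewrite mem_arcs; apply/idP/andP => [xyM|[xf /eqP fx]].
  by rewrite (lt_M _ xyM) (f1 _ xyM).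
have [p pM [xE|xE]] := ex x; first by rewrite -fx xE f1 // -surjective_pairing.
have := lt_M _ pM; rewrite -(f2 p pM) -xE fx => /(ltn_trans xf).
by rewrite ltnn.
Qed.

(** Counting positions from 0, the arcs opened at 0, 1, 2 close at 5 - 2, 5 - 0, 5 - 1, which gives
    the order of [f a], [f c], [f b]. *)
Lemma contains_312P f :
  reflect (exists a b c : 'I_(2 * n), [/\ a < b, b < c, c < f a, f a < f c & f c < f b])
    (contains_pattern (arcs f) p312).
Proof.
apply: (iffP existsP) => [[i /andP[/forallP mono /forallP inM]]|[a [b [c [ab bc ca ac cb]]]]].
  have lt_i (u v : 'I_(3 + 3)) : u < v -> i u < i v.
    by move=> uv; have /forallP/(_ v)/implyP := mono u; apply.
  have E (u v : 'I_(3 + 3)) : val u = val v -> i u = i v by move=> /val_inj ->.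
  have fi (j : 'I_3) : f (i (lshift 3 j)) = i (rev_ord (lshift 3 (p312 j))).
    by have := inM j; rewrite mem_arcs => /andP[_ /eqP].
  pose o0 : 'I_3 := @Ordinal 3 0 isT; pose o1 : 'I_3 := @Ordinal 3 1 isT.
  pose o2 : 'I_3 := @Ordinal 3 2 isT.
  exists (i (lshift 3 o0)), (i (lshift 3 o1)), (i (lshift 3 o2)).
  by rewrite !fi /p312 !permE /f312 !(tnth_nth o0) /=; split; apply: lt_i.
pose s := [:: a; b; c; f a; f c; f b].
exists [ffun k : 'I_(3 + 3) => nth a s k]; apply/andP; split.
  have srt : sorted ltn (map val s) by rewrite /= ab bc ca ac cb.
  apply/forallP => u; apply/forallP => v; apply/implyP => uv; rewrite !ffunE.
  rewrite -!(nth_map a 0 val) ?ltn_ord //.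
  by apply: (sorted_ltn_nth ltn_trans) => //; rewrite inE /= ltn_ord.
have lt1 := ltn_trans ab bc; have lt2 := ltn_trans bc ca; have lt3 := ltn_trans ca ac.
apply/forallP => j; rewrite !ffunE mem_arcs /p312 permE /f312.
case: j => -[|[|[|//]]] hj; rewrite (tnth_nth (@Ordinal 3 0 isT)) /= ?eqxx ?andbT.
- exact: ltn_trans lt1 ca.
- exact: ltn_trans lt2 (ltn_trans ac cb).
- exact: lt3.
Qed.

End Arcs.

(** Before anything is read, the completions are exactly the fixed-point-free involutions avoiding
    the pattern. *)
Theorem card_matchings_312 n :
  #|matchings_avoiding n p312| = walks (2 * n) (fun s => (s == [::]) : nat).
Proof.
rewrite /walks -(@card_completions (2 * n) (2 * n) [::] 0) //.
have cP f : completion_spec [::] 0 f <->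
    [/\ forall x, f (f x) = x, forall x, f x <> x
      & ~~ contains_pattern (@arcs n f) p312].
  split=> [C|[ff fne nc]].
    split; [exact: (compl_inv C)|by move=> x; apply/(compl_fix C)|].
    apply/negP => /contains_312P[a [b [c [ab bc ca ac cb]]]].
    exact: (compl_avoid C ab bc ca ac cb).
  split=> // a b c ab bc ca ac cb.
  by move/contains_312P: nc; apply; exists a, b, c.
rewrite -(@card_in_imset _ _ (@arcs n)); last first.
  move=> f g /[!inE] /completionP/cP[ff fne _] /completionP/cP[gg _ _].
  exact: arcs_inj.
apply: eq_card => M; rewrite !inE; apply/andP/imsetP => [[]|[f]].
  move=> /perfect_matchingP[f [ff fne ->]] nc; exists f => //.
  by rewrite inE; apply/completionP/cP.
rewrite inE => /completionP/cP[ff fne nc] ->; split=> //.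
exact: perfect_matching_arcs.
Qed.

(** * Power series *)

From mathcomp Require Import all_classical all_reals all_analysis.
Import numFieldNormedType.Exports.

Local Open Scope classical_set_scope.
Local Open Scope ring_scope.

(** * Cauchy products *)

Section Convolution.
Variable R : realType.
Implicit Types a b : R^nat.

Definition convolution a b : R^nat := fun n => \sum_(i < n.+1) a i * b (n - i)%N.

Lemma series_convolution a b n :
  series (convolution a b) n = \sum_(i < n) a i * series b (n - i)%N.
Proof.
elim: n => [|n IH]; first by rewrite big_ord0 /series /= big_geq.
rewrite seriesSr IH big_ord_recr /= subSnn /convolution.
rewrite [in X in _ + X]big_ord_recr /= subnn addrA -big_split /=.
congr (_ + _ * _); last by rewrite /series /= big_nat1.
by apply: eq_bigr => i _; rewrite subSn ?(ltnW (ltn_ord i)) // seriesSr mulrDr.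
Qed.

Lemma le_series_ge0 a : (forall n, 0 <= a n) -> {homo series a : m n / (m <= n)%N >-> m <= n}.
Proof.
move=> a0 m n mn; rewrite -subr_ge0 sub_series_geq //.
by apply: sumr_ge0 => i _.
Qed.

(** The terms of the product with both indices below n/2 bound its partial sum from below, and those
    with both indices below n bound it from above. *)
Lemma cvg_convolution_ge0 a b (la lb : R) : (forall n, 0 <= a n) -> (forall n, 0 <= b n) ->
  series a @ \oo --> la -> series b @ \oo --> lb ->
  series (convolution a b) @ \oo --> la * lb.
Proof.
move=> a0 b0 cva cvb.
have half : (fun n => n./2) @ \oo --> \oo.
  move=> P [N _ NP]; exists N.*2 => // n /= Nn; apply: NP => /=.
  by rewrite -(doubleK N) half_leq.
apply: (@squeeze_cvgr _ _ _ _ (fun n => series a n./2 * series b n./2)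
                              (fun n => series a n * series b n)).
- have E m x : series a m * x = \sum_(i < m) a i * x.
    by rewrite /series /= mulr_suml big_mkord.
  apply: nearW => n; rewrite series_convolution !E; apply/andP; split.
    rewrite (big_ord_widen n (fun i => a i * _)); last by lia.
    rewrite big_mkcond /=; apply: ler_sum => i _; case: ifP => hi.
      apply: ler_wpM2l => //; apply: (le_series_ge0 b0); lia.
    by apply: mulr_ge0 => //; apply: sumr_ge0.
  apply: ler_sum => i _; apply: ler_wpM2l => //.
  by apply: (le_series_ge0 b0); exact: leq_subr.
- by apply: cvgM; [apply: cvg_comp half cva|apply: cvg_comp half cvb].
- exact: cvgM.
Qed.

(** The gap between the product of the partial sums and the partial sum of the convolution is
    dominated by the same gap for absolute values, which tends to 0 by the nonnegative case. *)
Lemma cvg_convolution a b (la lb : R) :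
  cvgn (series (fun n => `|a n|)) -> cvgn (series (fun n => `|b n|)) ->
  series a @ \oo --> la -> series b @ \oo --> lb ->
  series (convolution a b) @ \oo --> la * lb.
Proof.
move=> cna cnb cva cvb.
pose na n := `|a n|; pose nb n := `|b n|.
have cabs := @cvg_convolution_ge0 na nb _ _ (fun n => normr_ge0 _) (fun n => normr_ge0 _) cna cnb.
have cd : (fun n => series na n * series nb n - series (convolution na nb) n) @ \oo --> (0 : R).
  by rewrite -(subrr (limn (series na) * limn (series nb))); apply: cvgB => //; apply: cvgM.
have cab : (fun n => series a n * series b n) @ \oo --> la * lb by exact: cvgM.
apply: (cvg_sub0 _ cab).
apply: norm_cvg0; apply: (@squeeze_cvgr _ _ _ _ (fun=> 0) _) cd => //; last exact: cvg_cst.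
apply: nearW => n; rewrite normr_ge0 /=.
have E (f : R^nat) m x : series f m * x = \sum_(i < m) f i * x.
  by rewrite /series /= mulr_suml big_mkord.
have -> : (series (convolution a b) - (fun n => series a n * series b n)) n =
    series (convolution a b) n - series a n * series b n by [].
rewrite distrC !series_convolution !E -!sumrB.
apply: (le_trans (ler_norm_sum _ _ _)); apply: ler_sum => i _.
rewrite -!mulrBr normrM; apply: ler_wpM2l => //.
have le_i := leq_subr i n.
rewrite !sub_series_geq //; exact: ler_norm_sum.
Qed.

Lemma cvgnS (u : R^nat) (l : R) : (fun n => u n.+1) @ \oo --> l <-> u @ \oo --> l.
Proof. by rewrite -(cvg_shiftS u). Qed.

Definition shift_seq a : R^nat := fun n => if n is n'.+1 then a n' else 0.

Lemma cvg_series_shift a (z l : R) : series (fun n => a n * z ^+ n) @ \oo --> l ->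
  series (fun n => shift_seq a n * z ^+ n) @ \oo --> z * l.
Proof.
move=> cl; apply/cvgnS.
rewrite (_ : (fun n => _) = (fun n => z * series (fun n => a n * z ^+ n) n)).
  by apply: cvgM => //; exact: cvg_cst.
apply/funext => n; rewrite /series /= big_nat_recl //= mul0r add0r mulr_sumr.
by apply: eq_bigr => i _; rewrite exprS mulrCA.
Qed.

End Convolution.

(** * Uniqueness of power series coefficients *)

Section Uniqueness.
Variable R : realType.

(** The terms are bounded at [rho], so letting z tend to 0 from the right kills the constant term;
    dividing by the power of z already known to factor out gives the other coefficients in turn. *)
Lemma pseries_eq0 (c : R^nat) (rho : R) : 0 < rho ->
  (forall z, 0 < z <= rho -> series (fun n => c n * z ^+ n) @ \oo --> (0 : R)) ->
  forall n, c n = 0.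
Proof.
move=> rho0.
have main (d : R^nat) :
    (forall z, 0 < z <= rho -> series (fun n => d n * z ^+ n) @ \oo --> (0 : R)) -> d 0%N = 0.
  move=> H.
  have [M [_ /(_ (M + 1))]] : bounded_fun (fun n => d n * rho ^+ n).
    by apply: cvg_series_bounded; apply/cvg_ex; exists 0; apply: H; rewrite rho0 lexx.
  rewrite ltrDl ltr01 => /(_ isT); set K := M + 1 => /= HK.
  have {}HK n : `|d n * rho ^+ n| <= K by exact: HK.
  have K0 : 0 <= K := le_trans (normr_ge0 _) (HK 0%N).
  have bd s : 0 < s -> s <= 2^-1 -> `|d 0%N| <= 2 * K * s.
    move=> s0 s1; have s1' : s < 1 by lra.
    have cv := H (s * rho); rewrite mulr_gt0 // in cv.
    have {}cv := cv (ler_piMl (ltW rho0) (ltW s1')).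
    have cvd : (fun n => `|d 0%N - series (fun n => d n * (s * rho) ^+ n) n.+1|) @ \oo -->
        `|d 0%N - 0|.
      by apply: cvg_norm; apply: cvgB; [exact: cvg_cst|rewrite cvg_shiftS].
    rewrite subr0 in cvd.
    apply: (cvgr_to_le cvd); apply: nearW => n.
    rewrite {1}/series /= big_nat_recl //= expr0 mulr1 opprD addrA subrr sub0r normrN.
    apply: (le_trans (ler_norm_sum _ _ _)).
    have -> : 2 * K * s = K * s * 2 by ring.
    apply: (@le_trans _ _ (K * s * series (geometric 1 s) n)).
      rewrite /series /= mulr_sumr; apply: ler_sum => i _.
      have -> : d i.+1 * (s * rho) ^+ i.+1 = d i.+1 * rho ^+ i.+1 * s ^+ i.+1.
        by rewrite exprMn; ring.
      have -> : K * s * geometric 1 s i = K * s ^+ i.+1 by rewrite /= exprS; ring.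
      have si0 := exprn_ge0 i.+1 (ltW s0).
      by rewrite normrM (ger0_norm si0); apply: ler_wpM2r => //; exact: HK.
    apply: ler_wpM2l; first by rewrite mulr_ge0 ?(ltW s0).
    rewrite geometric_seriesE ?lt_eqF //=.
    rewrite ler_pdivrMr ?subr_gt0 // mul1r.
    have : 0 <= s ^+ n by rewrite exprn_ge0 ?ltW.
    lra.
  apply/eqP; rewrite -normr_le0 leNgt; apply/negP => d0.
  (* Small enough that [2 * K * s] is below the norm of [d 0], and at most 1/2. *)
  pose s := `|d 0%N| / (4 * K + 2 * `|d 0%N| + 1).
  have den : 0 < 4 * K + 2 * `|d 0%N| + 1 by have := normr_ge0 (d 0%N); lra.
  have s0 : 0 < s by rewrite divr_gt0.
  have s1 : s <= 2^-1 by rewrite /s ler_pdivrMr //; lra.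
  have := bd s s0 s1; rewrite /s mulrA ler_pdivlMr //; nra.
move=> H n; elim/ltn_ind: n => n IH.
rewrite -[n in c n]addn0; apply: (main (fun k => c (n + k)%N)) => z /[dup] zr /andP[z0 _].
have cv := H z zr.
have E : (fun k => z ^- n * series (fun n => c n * z ^+ n) (k + n)%N) =
         series (fun k => c (n + k)%N * z ^+ k).
  apply/funext => k; rewrite series_addn {1}/series /= big_nat_cond big1 ?add0r; last first.
    by move=> i /andP[/andP[_ lin] _]; rewrite IH // mul0r.
  have -> (F : nat -> R) : \sum_(n <= i < k + n) F i = \sum_(0 <= i < k) F (i + n)%N.
    by rewrite -{1}[n]add0n big_addn addnK.
  rewrite mulr_sumr /series /=; apply: eq_bigr => i _.
  by rewrite addnC exprD mulrCA mulKf // expf_neq0 // gt_eqF.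
rewrite -E -(mulr0 (z ^- n)); apply: cvgM; first exact: cvg_cst.
by rewrite -(cvg_shiftn n) in cv.
Qed.

End Uniqueness.

(** * Roots of Lipschitz functions and interior minima of cubics *)

Section RealFunctions.
Variable R : realType.

(** The function is controlled only on the segment; composed with the clipping onto it, it is
    continuous on the whole line and the intermediate value theorem applies. *)
Lemma lipschitz_root (f : R -> R) (a b L : R) : a <= b ->
  (forall x y, a <= x -> x <= y -> y <= b -> `|f y - f x| <= L * (y - x)) ->
  f b <= 0 <= f a -> exists2 c, a <= c <= b & f c = 0.
Proof.
move=> ab lip fab.
pose clip x := Num.max a (Num.min x b).
have clipP x : a <= clip x <= b.
  by rewrite /clip le_max lexx /= ge_max ab /= ge_min lexx orbT.
have clip_id x : a <= x <= b -> clip x = x.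
  by case/andP=> ax xb; rewrite /clip min_l // max_r.
have clip_homo x y : x <= y -> clip x <= clip y.
  by move=> xy; rewrite /clip ge_max !le_max lexx /= le_min !ge_min xy lexx !orbT.
have clip_lip x y : x <= y -> clip y - clip x <= y - x.
  move=> xy; rewrite /clip !maxEle !minEle.
  case: (boolP (x <= b)); case: (boolP (y <= b)); rewrite -?ltNge => ? ?;
    by do ![case: ifPn; rewrite -?ltNge => ?]; lra.
have lip' x y : x <= y -> `|f (clip y) - f (clip x)| <= `|L| * (y - x).
  move=> xy; have [/andP[ax _] /andP[_ yb]] := (clipP x, clipP y).
  apply: (le_trans (lip _ _ ax (clip_homo _ _ xy) yb)).
  have h0 : 0 <= clip y - clip x by rewrite subr_ge0 clip_homo.
  apply: (le_trans (ler_wpM2r h0 (ler_norm L))); apply: ler_wpM2l => //.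
  exact: clip_lip.
have lip2 x y : `|f (clip x) - f (clip y)| <= `|L| * `|x - y|.
  have [xy|/ltW yx] := leP x y.
    by rewrite distrC [`|x - y|]distrC [`|y - x|]ger0_norm ?subr_ge0 // lip'.
  by rewrite [`|x - y|]ger0_norm ?subr_ge0 // lip'.
have cont : continuous (f \o clip).
  move=> x; apply/cvgrPdist_lt => e e0.
  have d0 : 0 < e / (`|L| + 1) by rewrite divr_gt0 // ltr_pwDr.
  near=> y; apply: (le_lt_trans (lip2 x y)).
  have : `|x - y| < e / (`|L| + 1) by near: y; apply: cvgr_dist_lt => //.
  rewrite ltr_pdivlMr; last by rewrite ltr_pwDr.
  have := normr_ge0 (x - y); have := normr_ge0 L; nra.
have [|c] := @IVT R (f \o clip) a b 0 ab (continuous_subspaceT cont).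
  rewrite /= !clip_id ?lexx ?ab //; case/andP: fab => fb fa.
  by rewrite ge_min le_max fb fa orbT.
rewrite in_itv /= => cab; rewrite clip_id // => fc.
by exists c.
Unshelve. all: by end_near.
Qed.

(** The derivative vanishes at an interior minimum. A small [h] of sign opposite to [k] would make
    the polynomial negative. *)
Lemma linear_coef_eq0 (k c1 c2 c3 d : R) : 0 < d ->
  (forall h, `|h| <= d -> 0 <= h * (k + h * (c1 + h * (c2 + h * c3)))) -> k = 0.
Proof.
move=> d0 H; pose C := `|c1| + `|c2| + `|c3|.
have C0 : 0 <= C by rewrite /C !addr_ge0.
have bd h : `|h| <= 1 -> `|h * (c1 + h * (c2 + h * c3))| <= `|h| * C.
  move=> h1; rewrite normrM; apply: ler_wpM2l => //.
  apply: (le_trans (ler_normD _ _)); rewrite /C -addrA lerD2l normrM.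
  apply: (le_trans (ler_piMl _ h1)) => //.
  apply: (le_trans (ler_normD _ _)); rewrite lerD2l normrM.
  by apply: (le_trans (ler_piMl _ h1)).
apply/eqP; rewrite -normr_le0 leNgt; apply/negP => k0.
(* This size keeps the higher terms below half of the linear one. *)
pose h0 := Num.min d (Num.min 1 (`|k| / (2 * (C + 1)))).
have C1 : 0 < 2 * (C + 1) by lra.
have h00 : 0 < h0 by rewrite !lt_min d0 ltr01 /= divr_gt0.
have h0d : h0 <= d by rewrite ge_min lexx.
have h01 : h0 <= 1 by rewrite !ge_min lexx /= orbT.
have h0k : h0 * (2 * (C + 1)) <= `|k|.
  by rewrite -ler_pdivlMr // !ge_min lexx !orbT.
pose h := - Num.sg k * h0.
have nh : `|h| = h0.
  by rewrite normrM normrN normr_sg -normr_gt0 k0 mul1r gtr0_norm.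
have := H h; rewrite nh => /(_ h0d).
have := bd h; rewrite nh => /(_ h01).
set X := h * (c1 + _) => bX; rewrite mulrDr.
have -> : h * k = - (h0 * `|k|) by rewrite /h normrEsg; ring.
have : h * X <= h0 * `|X| by rewrite -nh -normrM ler_norm.
have := normr_ge0 X; nra.
Qed.

End RealFunctions.

(** * The kernel equation *)

Section SmallStep.
Variables (R : realType) (t : R).
Hypothesis t_gt0 : 0 < t.
Hypothesis t_le : t <= 16^-1.

Let total_term v : R^nat := fun m => total_poly m v * t ^+ m.

Lemma total_term_ge0 v m : 0 <= v -> 0 <= total_term v m.
Proof. by move=> v0; rewrite mulr_ge0 ?total_poly_ge0 // exprn_ge0 // ltW. Qed.

Lemma is_cvg_total v : 0 <= v <= 1 -> cvgn (series (total_term v)).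
Proof.
have t0 := t_gt0; have t16 := t_le.
move=> v01; apply: (@series_le_cvg _ _ (geometric 1 (4 * t))).
- by move=> m; apply: total_term_ge0; case/andP: v01.
- by move=> m; rewrite /= mul1r exprn_ge0 // mulr_ge0 ?ltW.
- move=> m; rewrite /= mul1r exprMn; apply: ler_wpM2r; last exact: total_poly_le.
  by rewrite exprn_ge0 // ltW.
- by apply: is_cvg_geometric_series; rewrite ger0_norm; lra.
Qed.

Let U v := limn (series (total_term v)).
Let F := U 0.

Lemma cvg_excursions : series (fun m => excursions R m * t ^+ m) @ \oo --> F.
Proof.
have := @is_cvg_total 0; rewrite lexx ler01 => /(_ isT).
rewrite (_ : (fun m => _) = total_term 0) //.
by apply/funext => m; rewrite /total_term total_poly0r.
Qed.

Lemma excursions_ge1 : 1 <= F.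
Proof.
apply: (cvgr_to_ge cvg_excursions); exists 1%N => // n /= n0.
rewrite -(prednK n0) /series /= big_nat_recl //= mulr1 lerDl.
by apply: sumr_ge0 => i _; rewrite mulr_ge0 ?excursions_ge0 // exprn_ge0 // ltW.
Qed.

Lemma excursions_le : F <= 2.
Proof.
have t0 := t_gt0; have t16 := t_le.
have [c4 c5] : 4 * t < 1 /\ 0 <= 4 * t by lra.
apply: (cvgr_to_le cvg_excursions); apply: nearW => n.
apply: (@le_trans _ _ (series (geometric 1 (4 * t)) n)).
  apply: ler_sum => m _; rewrite /= mul1r exprMn ler_wpM2r //.
    by rewrite exprn_ge0 // ltW.
  by rewrite -total_poly0r total_poly_le // lexx ler01.
rewrite geometric_seriesE ?lt_eqF //= ler_pdivrMr ?subr_gt0 //.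
have : 0 <= (4 * t) ^+ n by rewrite exprn_ge0.
lra.
Qed.

(** As [m * 4 ^ m] is at most [8 ^ m], the termwise constants are dominated by a geometric series of
    ratio [8 * t], at most 1/2, whose sum is at most 2. *)
Lemma total_lipschitz v w : 0 <= v -> v <= w -> w <= 1 -> 0 <= U w - U v <= 2 * (w - v).
Proof.
have t0 := t_gt0; have t16 := t_le.
move=> v0 vw w1.
have cw : series (total_term w) @ \oo --> U w by apply: is_cvg_total; rewrite (le_trans v0).
have cv : series (total_term v) @ \oo --> U v by apply: is_cvg_total; rewrite v0 (le_trans vw).
have c : (fun n => series (total_term w) n - series (total_term v) n) @ \oo --> U w - U v.
  exact: cvgB.
have bd m : 0 <= total_term w m - total_term v m <= (8 * t) ^+ m * (w - v).
  rewrite /total_term -mulrBl.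
  have vw0 : 0 <= v <= w by rewrite v0.
  have /andP[l u] := total_poly_lipschitz m vw0 w1.
  have tm : 0 <= t ^+ m by rewrite exprn_ge0 // ltW.
  rewrite mulr_ge0 //=; apply: (le_trans (ler_wpM2r tm u)).
  rewrite exprMn mulrAC; apply: ler_wpM2r; first by rewrite subr_ge0.
  apply: ler_wpM2r => //; rewrite (_ : 8 = 2 * 4); last by ring.
  rewrite exprMn; apply: ler_wpM2r; first by rewrite exprn_ge0.
  by rewrite -natrX ler_nat; apply: ltnW; apply: ltn_expl.
have [c8 c9] : 8 * t <= 2^-1 /\ 0 <= 8 * t by lra.
apply/andP; split.
  apply: (cvgr_to_ge c); apply: nearW => n.
  rewrite -sumrB; apply: sumr_ge0 => i _; by have /andP[] := bd i.
apply: (cvgr_to_le c); apply: nearW => n.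
apply: (@le_trans _ _ (series (geometric 1 (8 * t)) n * (w - v))).
  rewrite -sumrB mulr_suml; apply: ler_sum => i _; rewrite /= mul1r.
  by have /andP[] := bd i.
apply: ler_wpM2r; first by rewrite subr_ge0.
rewrite geometric_seriesE ?lt_eqF //=; last by lra.
rewrite ler_pdivrMr ?subr_gt0 //; last by lra.
have : 0 <= (8 * t) ^+ n by rewrite exprn_ge0.
lra.
Qed.

(** This is U = F + A U with A expressed through U and F, after multiplication by [v]. *)
Lemma total_equation v : 0 < v -> v <= 1 ->
  t * U v ^+ 2 - (t + v - t * v ^+ 2) * F * U v + v * F = 0.
Proof.
move=> v0 v1; have v0' := ltW v0; have vn0 : v != 0 by rewrite gt_eqF.
have cU : series (total_term v) @ \oo --> U v by apply: is_cvg_total; rewrite v0'.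
(* The sum of the recurrence for [first_block_poly]; the shifted excursion series contributes F -
   1. *)
pose A := t / v * (v ^+ 2 * F + U v - F) - (F - 1).
pose bterm m := first_block_poly m v * t ^+ m.
have b0 : bterm 0%N = 0 by rewrite /bterm /first_block_poly /= mul0r.
have cA : series bterm @ \oo --> A.
  apply/cvgnS.
  pose E := series (fun m => excursions R m * t ^+ m).
  rewrite (_ : (fun n => _) = (fun n => t / v * (v ^+ 2 * E n + series (total_term v) n - E n)
      - (E n.+1 - 1))); last first.
    apply/funext => n; rewrite /E /series /= [in LHS]big_nat_recl //= b0 add0r.
    rewrite [X in _ - (X - _)]big_nat_recl //= excursions0 ?expr0 mulr1 [1 + _]addrC addrK.
    rewrite mulr_sumr -big_split -sumrB mulr_sumr -sumrB; apply: eq_bigr => i _ /=.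
    rewrite /bterm /total_term; apply: (mulfI vn0).
    rewrite mulrA first_block_polyS (exprS t i); field.
    exact: vn0.
  apply: cvgB; last first.
    by apply: cvgB; [apply/(cvgnS E); exact: cvg_excursions|exact: cvg_cst].
  apply: cvgM; first exact: cvg_cst.
  apply: cvgB; last exact: cvg_excursions.
  apply: cvgD => //; apply: cvgM; [exact: cvg_cst|exact: cvg_excursions].
have bterm_ge0 m : 0 <= bterm m.
  by rewrite mulr_ge0 ?first_block_poly_ge0 // exprn_ge0 // ltW.
have tt0 m : 0 <= total_term v m by exact: total_term_ge0.
have cc := cvg_convolution_ge0 bterm_ge0 tt0 cA cU.
have cF := cvgD cvg_excursions cc.
have EU : U v = F + A * U v.
  apply: (@cvg_unique _ (@Rhausdorff R) _ _ _ _ cU).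
  suff -> : series (total_term v) = series (fun m => excursions R m * t ^+ m) +
     series (convolution bterm (total_term v)) by exact: cF.
  apply/funext => n; rewrite -seriesD; congr (series _ n); apply/funext => m.
  rewrite /total_term total_poly_first_block mulrDl; congr (_ + _).
  rewrite mulr_suml; apply: eq_bigr => i _; rewrite /bterm /total_term.
  have -> : t ^+ m = t ^+ (m - i) * t ^+ i by rewrite -exprD subnK // -ltnS.
  by ring.
have : v * U v = v * (F + A * U v) by rewrite -EU.
rewrite /A => /eqP; rewrite -subr_eq0 => /eqP E; rewrite -[RHS]oppr0 -E; field.
exact: vn0.
Qed.

Lemma excursions_sqrt : exists2 F,
  series (fun m => excursions R m * t ^+ m) @ \oo --> F &
  2 * (1 + 4 * t ^+ 2) ^+ 2 * F =
  1 + 36 * t ^+ 2 + (1 - 12 * t ^+ 2) * Num.sqrt (1 - 12 * t ^+ 2).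
Proof.
have t0 := t_gt0; have t16 := t_le.
exists F; first exact: cvg_excursions.
have F1 := excursions_ge1; have F2 := excursions_le.
pose P v := t + v - t * v ^+ 2.
(* Completing the square in the quadratic for [U v] makes [G v] a square root of its
   discriminant. *)
pose G v := 2 * t * U v - F * P v.
have GE v : 0 <= v -> v <= 1 -> G v ^+ 2 = F * (F * P v ^+ 2 - 4 * t * v).
  rewrite le_eqVlt => /predU1P[<- _|v0 v1].
    by rewrite /G /P -/F; ring.
  have E := total_equation v0 v1; apply/eqP; rewrite -subr_eq0; apply/eqP.
  by rewrite -[RHS](mulr0 (4 * t)) -E /G /P; ring.
have t2 : 0 <= 2 * t by lra.
have G0 : G 0 = t * F by rewrite /G /P -/F; ring.
have F0 : 0 < F by lra.
have tF : 0 < t * F by rewrite mulr_gt0 //; lra.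
(* [G] is positive at 0 and negative at [2 * t], so it vanishes in between. *)
have G2 : G (2 * t) < 0.
  have h : 2 * t <= 1 by lra.
  have /andP[_ u] := total_lipschitz (lexx 0) t2 h; rewrite -/F subr0 in u.
  have -> : G (2 * t) = t * (2 * (U (2 * t) - F) - F + 4 * t ^+ 2 * F).
    by rewrite /G /P; ring.
  rewrite pmulr_rlt0 //; have : t ^+ 2 * F <= 256^-1 * 2.
    have tt : t ^+ 2 <= 256^-1 by nra.
    have tt0 : 0 <= t ^+ 2 by exact: sqr_ge0.
    by apply: ler_pM => //; lra.
  lra.
have [Y /andP[Y0 Y2] GY] : exists2 Y, 0 <= Y <= 2 * t & G Y = 0.
  apply: (@lipschitz_root _ _ _ _ (4 * t + 4)) => //.
    move=> x y x0 xy y2.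
    have y1 : y <= 1 by lra.
    have /andP[l u] := total_lipschitz x0 xy y1.
    have -> : G y - G x = 2 * t * (U y - U x) - F * ((y - x) * (1 - t * (x + y))).
      by rewrite /G /P; ring.
    have q0 : 0 <= 1 - t * (x + y) <= 1 by nra.
    case/andP: q0 => q0 q1.
    have d0 : 0 <= y - x by lra.
    have dq : 0 <= (y - x) * (1 - t * (x + y)) <= y - x.
      by rewrite mulr_ge0 //= ler_piMr.
    case/andP: dq => dq0 dq1.
    set d := (y - x) * _ in dq0 dq1 *.
    have Fd0 : 0 <= F * d by rewrite mulr_ge0 //; lra.
    have Fd1 : F * d <= 2 * (y - x) by apply: ler_pM => //; lra.
    have tU0 : 0 <= 2 * t * (U y - U x) by rewrite mulr_ge0.
    have tU1 : 2 * t * (U y - U x) <= 2 * t * (2 * (y - x)) by rewrite ler_wpM2l.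
    rewrite ler_norml mulrDl; lra.
  by rewrite G0 !ltW.
have Ypos : 0 < Y.
  rewrite lt_def Y0 andbT; apply/eqP => YE; move: GY; rewrite YE G0 => E.
  by rewrite E ltxx in tF.
have Ylt : Y < 2 * t.
  rewrite lt_def Y2 andbT; apply/eqP => YE.
  by rewrite YE GY ltxx in G2.
have DY : F * P Y ^+ 2 = 4 * t * Y.
  have := GE Y Y0; rewrite GY expr0n /= => /(_ _)/esym/eqP.
  rewrite mulf_eq0 gt_eqF /=; last by lra.
  by rewrite subr_eq0 => H; apply/eqP/H; lra.
(* [F * P v ^+ 2 - 4 * t * v] is nonnegative, as [F] times it is a square, and
   vanishes at [Y], hence so does its derivative. *)
have D1 : F * P Y * (1 - 2 * t * Y) = 2 * t.
  suff : 2 * (F * P Y * (1 - 2 * t * Y)) - 4 * t = 0 by lra.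
  pose q := 1 - 2 * t * Y.
  (* The coefficients are those of the expansion at [Y]; the radius keeps [Y + h] between 0 and
     [2 * t], where [GE] applies. *)
  apply: (@linear_coef_eq0 _ _ (F * (q ^+ 2 - 2 * t * P Y)) (- 2 * F * t * q) (F * t ^+ 2)
    (Num.min Y (2 * t - Y))); first by rewrite lt_min Ypos subr_gt0.
  move=> h; rewrite le_min => /andP[hY hY2].
  have [h1 h2] : - Y <= h /\ h <= 2 * t - Y.
    by move: hY hY2; rewrite !ler_norml; lra.
  have Yh0 : 0 <= Y + h by lra.
  have Yh1 : Y + h <= 1 by lra.
  have := sqr_ge0 (G (Y + h)); rewrite GE // (pmulr_rge0 _ F0).
  suff -> : F * P (Y + h) ^+ 2 - 4 * t * (Y + h) =
     F * P Y ^+ 2 - 4 * t * Y + h * (2 * (F * P Y * (1 - 2 * t * Y)) - 4 * t +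
       h * (F * (q ^+ 2 - 2 * t * P Y) + h * (- 2 * F * t * q + h * (F * t ^+ 2)))).
    by rewrite DY subrr add0r.
  by rewrite /P /q; ring.
have tn0 : t != 0 by rewrite gt_eqF.
(* Eliminating F between [DY] and [D1] leaves a quadratic equation for [Y]. *)
have PY : P Y = 2 * Y * (1 - 2 * t * Y).
  have : 2 * t * P Y = 2 * t * (2 * Y * (1 - 2 * t * Y)).
    have -> : 2 * t * P Y = F * P Y ^+ 2 * (1 - 2 * t * Y) by rewrite -{1}D1; ring.
    by rewrite DY; ring.
  by apply: mulfI; rewrite mulf_neq0 // pnatr_eq0.
have quad : 3 * t * Y ^+ 2 - Y + t = 0 by move: PY; rewrite /P; nra.
(* The square root of the discriminant of that quadratic; it is nonnegative since [Y] lies below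
   [2 * t]. *)
pose w := 1 - 6 * t * Y.
have w2 : w ^+ 2 = 1 - 12 * t ^+ 2.
  have -> : w ^+ 2 = 1 - 12 * t ^+ 2 + 12 * t * (3 * t * Y ^+ 2 - Y + t) by rewrite /w; ring.
  by rewrite quad mulr0 addr0.
have w0 : 0 <= w by rewrite /w; nra.
rewrite -w2 sqrtr_sqr (ger0_norm w0).
have t2E : t ^+ 2 = (1 - w ^+ 2) / 12 by rewrite w2; field.
(* Everything is rational in [w]: 6 t Y = 1 - w, 1 - 2 t Y = (2 + w) / 3 and 1 + 4 t^2 = (2 - w) (2
   + w) / 3. *)
have FE : F * (2 + w) ^+ 2 = 9 * (1 + w) / 2.
  have E1 : F * Y * (1 - 2 * t * Y) ^+ 2 = t.
    apply: (@mulfI _ (4 * Y)); first by rewrite mulf_neq0 ?pnatr_eq0 ?gt_eqF.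
    by rewrite [RHS]mulrAC -DY PY; ring.
  have w1 : 1 - w != 0 by rewrite /w gt_eqF // opprB addrC subrK !mulr_gt0.
  apply: (mulfI w1).
  have -> : (1 - w) * (F * (2 + w) ^+ 2) = 54 * t * (F * Y * (1 - 2 * t * Y) ^+ 2).
    by rewrite /w; ring.
  by rewrite E1 -mulrA -expr2 t2E; field.
have E3 : 2 * (1 + 4 * t ^+ 2) ^+ 2 * F = 2 / 9 * (2 - w) ^+ 2 * (F * (2 + w) ^+ 2).
  by rewrite t2E; field.
by rewrite E3 FE t2E; field.
Qed.

End SmallStep.

(** * Power series of (1 - x)^(1/2) and (1 - x)^(3/2) *)

Section SqrtSeries.
Variable R : realType.

(* [central_ratio n] is the probability 'C(2n, n) / 4 ^ n. *)
Definition central_ratio (n : nat) : R := \prod_(i < n) ((2 * i%:R + 1) / (2 * i%:R + 2)).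

(** The Taylor coefficients of the square root of 1 - x. *)
Definition sqrt_coef n : R := central_ratio n / (1 - 2 * n%:R).

Lemma central_ratioS n : central_ratio n.+1 = central_ratio n * ((2 * n%:R + 1) / (2 * n%:R + 2)).
Proof. by rewrite /central_ratio big_ord_recr. Qed.

Lemma central_ratio0 : central_ratio 0 = 1.
Proof. by rewrite /central_ratio big_ord0. Qed.

Lemma central_ratio_gt0 n : 0 < central_ratio n.
Proof.
have h i : 0 <= i%:R :> R by [].
elim: n => [|n IH]; first by rewrite central_ratio0.
by rewrite central_ratioS mulr_gt0 // divr_gt0 //; have := h n; lra.
Qed.

Lemma sqrt_coef0 : sqrt_coef 0 = 1.
Proof. by rewrite /sqrt_coef central_ratio0 mulr0 subr0 divr1. Qed.

Lemma sqrt_coefS n : sqrt_coef n.+1 = - central_ratio n / (2 * n%:R + 2).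
Proof.
have h : 0 <= n%:R :> R by [].
rewrite /sqrt_coef central_ratioS -natr1; field.
by apply/andP; split; apply/eqP => E; lra.
Qed.

Lemma sqrt_coef_rec n : n.+1%:R * sqrt_coef n.+1 = (n%:R - 2^-1) * sqrt_coef n.
Proof.
have h : 0 <= n%:R :> R by [].
rewrite sqrt_coefS /sqrt_coef -natr1; field.
apply/andP; split; last by apply/eqP => E; lra.
apply/eqP => E; have : (2 * n)%:R = 1%:R :> R by rewrite natrM; lra.
by move/eqP; rewrite eqr_nat => /eqP; lia.
Qed.

Lemma series_sqrt_coef n : series sqrt_coef n.+1 = central_ratio n.
Proof.
have h i : 0 <= i%:R :> R by [].
elim: n => [|n IH]; first by rewrite /series /= big_nat1 sqrt_coef0 central_ratio0.
rewrite seriesSr IH sqrt_coefS central_ratioS; field.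
by apply/eqP => E; have := h n; lra.
Qed.

(** Only the constant coefficient is positive, so the telescoped sum also yields the absolute one,
    hence absolute convergence up to radius 1. *)
Lemma series_norm_sqrt_coef n :
  series (fun n => `|sqrt_coef n|) n.+1 = 2 - central_ratio n.
Proof.
have h i : 0 <= i%:R :> R by [].
elim: n => [|n IH]; first by rewrite /series /= big_nat1 sqrt_coef0 central_ratio0 normr1; ring.
have E : `|sqrt_coef n.+1| = - sqrt_coef n.+1.
  by apply: ler0_norm; rewrite sqrt_coefS mulNr oppr_le0 divr_ge0 ?(ltW (central_ratio_gt0 _)) //.
rewrite seriesSr IH E -(series_sqrt_coef n.+1) seriesSr series_sqrt_coef; ring.
Qed.

(** The recurrence for the coefficients encodes 2 (1 - x) s' = - s. The square c of s then satisfies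
    (1 - x) c' = - c, which forces c = 1 - x. *)
Lemma sqrt_coef_square n :
  convolution sqrt_coef sqrt_coef n = (n == 0%N)%:R - (n == 1%N)%:R.
Proof.
pose c := convolution sqrt_coef sqrt_coef.
(* The coefficients of x s s', that is half of x c' by symmetry. *)
pose d n := \sum_(i < n.+1) i%:R * (sqrt_coef i * sqrt_coef (n - i)%N).
have dc k : 2 * d k = k%:R * c k.
  rewrite mulr_natl mulr2n {2}/d (reindex_inj rev_ord_inj) /= -big_split /= /c /convolution.
  rewrite mulr_sumr; apply: eq_bigr => i _.
  rewrite subSS subKn -1?ltnS // [sqrt_coef (k - i)%N * _]mulrC -mulrDl -natrD subnKC -1?ltnS //.
have cS k : k.+1%:R * c k.+1 = (k%:R - 1) * c k.
  rewrite -dc /d big_ord_recl mul0r add0r mulrBl mul1r -dc /c /convolution /d.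
  rewrite !mulr_sumr -sumrB; apply: eq_bigr => i _.
  rewrite lift0 subSS; set y := sqrt_coef (k - i)%N.
  have := sqrt_coef_rec i; move: (sqrt_coef i.+1) (i.+1%:R) => B A H.
  have -> : 2 * (A * (B * y)) = 2 * (A * B) * y by ring.
  by rewrite H; field.
have c0 : c 0%N = 1 by rewrite /c /convolution big_ord1 subnn sqrt_coef0 mulr1.
have c1 : c 1%N = -1 by have := cS 0%N; rewrite c0 mul1r sub0r mulr1.
have nz k : k.+1%:R != 0 :> R by rewrite pnatr_eq0.
have c2 k : c k.+2 = 0.
  elim: k => [|k IH].
    by apply: (mulfI (nz 1%N)); rewrite cS subrr mul0r mulr0.
  by apply: (mulfI (nz k.+2)); rewrite cS IH !mulr0.
rewrite -/c; case: n => [|[|n]]; rewrite ?c0 ?c1 ?c2 /=; ring.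
Qed.

(** By the Cauchy product the sum squares to 1 - x. It is the nonnegative root because the terms
    after the constant 1 have total size at most 1. *)
Lemma cvg_sqrt_series x : `|x| < 1 ->
  series (fun n => sqrt_coef n * x ^+ n) @ \oo --> Num.sqrt (1 - x).
Proof.
move=> x1.
have xn n : `|x ^+ n| <= 1 by rewrite normrX exprn_ile1 // ltW.
have cb : cvgn (series (fun n => `|sqrt_coef n|)).
  apply: nondecreasing_is_cvgn; first exact: le_series_ge0.
  exists 2 => _ [n _ <-]; apply: (@le_trans _ _ (series (fun n => `|sqrt_coef n|) n.+1)).
    exact: le_series_ge0.
  by rewrite series_norm_sqrt_coef gerBl ltW // central_ratio_gt0.
pose u n := sqrt_coef n * x ^+ n.
have cu : cvgn (series (fun n => `|u n|)).
  apply: series_le_cvg cb => // n; rewrite /u normrM -[leRHS]mulr1.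
  exact: ler_wpM2l.
have cv : series u @ \oo --> limn (series u) by exact: normed_cvg.
set B := limn (series u) in cv.
have B0 : 0 <= B.
  apply: (cvgr_to_ge (proj2 (cvgnS _ _) cv)); apply: nearW => n.
  rewrite /series /= big_nat_recl //= {1}/u expr0 mulr1 sqrt_coef0 addrC -lerBlDr sub0r.
  have : `|\sum_(0 <= i < n) u i.+1| <= 1.
    apply: (le_trans (ler_norm_sum _ _ _)).
    apply: (@le_trans _ _ (\sum_(0 <= i < n) `|sqrt_coef i.+1|)).
      apply: ler_sum => i _; rewrite /u normrM -[leRHS]mulr1; exact: ler_wpM2l.
    have := series_norm_sqrt_coef n; rewrite /series /= big_nat_recl //= sqrt_coef0 normr1.
    by have := central_ratio_gt0 n; lra.
  by rewrite ler_norml => /andP[].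
have cc := cvg_convolution cu cu cv cv.
have B2 : B * B = 1 - x.
  apply: (@cvg_unique _ (@Rhausdorff R) _ _ _ _ cc).
  have E : convolution u u = fun n => ((n == 0%N)%:R - (n == 1%N)%:R) * x ^+ n.
    apply/funext => n; rewrite -sqrt_coef_square /convolution mulr_suml.
    apply: eq_bigr => i _; rewrite /u mulrACA -exprD subnKC // -1?ltnS //.
  rewrite E; apply: cvg_near_cst.
  exists 2%N => // n /= n2; rewrite -(subnK n2) addn2 /series /= 2?big_nat_recl //= big1 => [|i _].
    by rewrite expr0 expr1; ring.
  by rewrite subrr mul0r.
by rewrite -B2 -expr2 sqrtr_sqr ger0_norm.
Qed.

(** The Taylor coefficients of (1 - x)^(3/2). *)
Definition sqrt3_coef n : R := 3 * central_ratio n / ((2 * n%:R - 1) * (2 * n%:R - 3)).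

Lemma odd_natr_neq0 n k : 2 * n%:R - (2 * k + 1)%:R != 0 :> R.
Proof.
rewrite subr_eq0 -natrM eqr_nat; apply/eqP; lia.
Qed.

Lemma sqrt3_coefE n : sqrt3_coef n = sqrt_coef n - shift_seq sqrt_coef n.
Proof.
have h m : 0 <= m%:R :> R by [].
have n1 m : 2 * m%:R - 1 != 0 :> R by have := odd_natr_neq0 m 0.
have n3 m : 2 * m%:R - 3 != 0 :> R by have := odd_natr_neq0 m 1.
case: n => [|n] /=.
  by rewrite /sqrt3_coef /sqrt_coef central_ratio0; field.
rewrite sqrt_coefS /sqrt3_coef /sqrt_coef central_ratioS -natr1; field.
have := n1 n; have := n3 n.+1; have := n1 n.+1; rewrite -natr1.
move=> e1 e2 e3; have n2 : 2 * n%:R + 2 != 0 :> R by apply/eqP => E; have := h n; lra.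
have q x y : x != 0 -> y = x -> y != 0 :> R by move=> + ->.
have q' x y : x != 0 -> y = - x -> y != 0 :> R by move=> + ->; rewrite oppr_eq0.
rewrite n2 /=; repeat (apply/andP; split);
  by [apply: (q _ _ e1); ring|apply: (q _ _ e2); ring
     |apply: (q _ _ e3); ring|apply: (q' _ _ e3); ring].
Qed.

Lemma cvg_sqrt3_series x : `|x| < 1 ->
  series (fun n => sqrt3_coef n * x ^+ n) @ \oo --> (1 - x) * Num.sqrt (1 - x).
Proof.
move=> x1; have c1 := cvg_sqrt_series x1; have c2 := cvg_series_shift c1.
rewrite mulrBl mul1r.
rewrite (_ : (fun n => _) = (fun n => sqrt_coef n * x ^+ n) +
    - (fun n => shift_seq sqrt_coef n * x ^+ n)); last first.
  by apply/funext => n; rewrite sqrt3_coefE mulrBl.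
by rewrite seriesD seriesN; apply: cvgB.
Qed.

End SqrtSeries.

(** * The closed form as an identity between coefficients *)

Lemma cvg_initial_terms (R : realType) (z : R) :
  series (fun k => ((k == 0%N)%:R + 36 * (k == 1%N)%:R) * z ^+ k) @ \oo --> 1 + 36 * z.
Proof.
apply: cvg_near_cst; exists 2%N => // k /= k2.
rewrite -(subnK k2) addn2 /series /= 2?big_nat_recl //= big1 => [|i _].
  by rewrite expr0 expr1; ring.
by rewrite mulr0 addr0 mul0r.
Qed.

Section CoefficientIdentity.
Variable R : realType.

(** Multiplication of the generating function by 1 + 4z. *)
Definition add_shift4 (f : R^nat) : R^nat := fun n => f n + 4 * shift_seq f n.

Lemma cvg_add_shift4 (f : R^nat) (z l : R) :
  series (fun n => f n * z ^+ n) @ \oo --> l ->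
  series (fun n => add_shift4 f n * z ^+ n) @ \oo --> (1 + 4 * z) * l.
Proof.
move=> cl; have c2 := cvg_series_shift cl.
rewrite (_ : (fun n => _) = (fun n => f n * z ^+ n) +
    4 *: (fun n => shift_seq f n * z ^+ n)); last first.
  by apply/funext => n; rewrite /add_shift4 mulrDl -mulrA.
rewrite seriesD seriesZ mulrDl mul1r -mulrA; apply: cvgD => //.
exact: cvgZr.
Qed.

(** The closed form is known for z = t^2 with 0 < t <= 1/16; uniqueness of coefficients extends it
    to an identity of formal series. *)
Lemma excursions_coef n :
  2 * add_shift4 (add_shift4 (fun k => excursions R (2 * k))) n =
  sqrt3_coef R n * 12 ^+ n + (n == 0%N)%:R + 36 * (n == 1%N)%:R.
Proof.
set f := fun k => _; set g := add_shift4 _.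
pose c k := 2 * g k - (sqrt3_coef R k * 12 ^+ k) - ((k == 0%N)%:R + 36 * (k == 1%N)%:R).
suff : c n = 0 by rewrite /c; lra.
apply: (@pseries_eq0 _ c (256^-1)); first by lra.
move=> z /andP[z0 z1].
pose t := Num.sqrt z.
have t2 : t ^+ 2 = z by rewrite sqr_sqrtr ?ltW.
have t0 : 0 < t by rewrite sqrtr_gt0.
have t1 : t <= 16^-1 by have : 0 < 16^-1 :> R by []; nra.
have [F cF EF] := excursions_sqrt t0 t1; rewrite t2 in EF.
(* Odd excursions vanish, so the even partial sums in t are the partial sums in z. *)
have cf : series (fun n => f n * z ^+ n) @ \oo --> F.
  rewrite (_ : series _ = (fun n => series (fun m => excursions R m * t ^+ m) (2 * n)%N)).
    apply: (@cvg_comp _ _ _ (fun n => (2 * n)%N) _ _ _ _ _ cF) => P [N _ NP].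
    by exists N => // k /= Nk; apply: NP => /=; lia.
  apply/funext; elim=> [|k IH]; first by rewrite muln0 /series /= !big_geq.
  rewrite seriesSr IH mulnS add2n !seriesSr /f exprM t2.
  by rewrite (excursions_odd _ (m := (2 * k).+1)) ?mul0r ?addr0 //= mul2n odd_double.
have cg := cvg_add_shift4 (cvg_add_shift4 cf).
have c12 : series (fun k => sqrt3_coef R k * 12 ^+ k * z ^+ k) @ \oo -->
    (1 - 12 * z) * Num.sqrt (1 - 12 * z).
  rewrite (_ : (fun k => _) = (fun k => sqrt3_coef R k * (12 * z) ^+ k)).
    by apply: cvg_sqrt3_series; rewrite ger0_norm; lra.
  by apply/funext => k; rewrite exprMn mulrA.
have cp := @cvg_initial_terms R z.
rewrite (_ : (fun k => _) = 2 *: (fun k => g k * z ^+ k) +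
   - (fun k => sqrt3_coef R k * 12 ^+ k * z ^+ k)
   + - (fun k => ((k == 0%N)%:R + 36 * (k == 1%N)%:R) * z ^+ k)); last first.
  by apply/funext => k; rewrite /c !mulrBl -mulrA.
rewrite !seriesD seriesZ !seriesN.
rewrite (_ : 0 = 2 *: ((1 + 4 * z) * ((1 + 4 * z) * F)) -
    (1 - 12 * z) * Num.sqrt (1 - 12 * z) - (1 + 36 * z)).
  by apply: cvgB => //; apply: cvgB => //; apply: cvgZr.
have -> : 2 *: ((1 + 4 * z) * ((1 + 4 * z) * F)) = 2 * (1 + 4 * z) ^+ 2 * F.
  by rewrite /GRing.scale /=; ring.
by rewrite EF; ring.
Qed.

End CoefficientIdentity.

(** * Asymptotics *)

Section Wallis.
Variable R : realType.

(* The primitive of [sin ^ n] that vanishes at 0. *)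
Fixpoint sin_primitive (n : nat) (x : R) : R :=
  match n with
  | 0 => x
  | 1 => 1 - cos x
  | n'.+2 => (n'.+1%:R * sin_primitive n' x - cos x * sin x ^+ n'.+1) / n'.+2%:R
  end.

Lemma is_derive_sin_primitive n (x : R) :
  is_derive x 1 (sin_primitive n : R -> R) (sin x ^+ n).
Proof.
suff H : is_derive x 1 (sin_primitive n : R -> R) (sin x ^+ n) /\
         is_derive x 1 (sin_primitive n.+1 : R -> R) (sin x ^+ n.+1) by case: H.
elim: n => [|n [IH1 IH2]].
  split; first exact: is_derive_id.
  have h := is_deriveB (is_derive_cst (1 : R) x 1) (is_derive_cos x).
  by apply: (is_derive_eq h); rewrite sub0r opprK expr1.
split=> //.
have h := is_deriveZ n.+2%:R^-1 (is_deriveB (is_deriveZ n.+1%:R IH1)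
  (is_deriveM (is_derive_cos x) (is_deriveX n.+1 (is_derive_sin x)))).
have E : n.+2%:R^-1 \*: (n.+1%:R \*: sin_primitive n - cos * sin ^+ n.+1) = sin_primitive n.+2.
  by apply/funext => y; rewrite /= !fctE [RHS]mulrC.
rewrite E in h; apply: (is_derive_eq h).
have n2 : n.+2%:R != 0 :> R by rewrite pnatr_eq0.
have c2 : cos x ^+ 2 = 1 - sin x ^+ 2 by rewrite -(cos2Dsin2 x); ring.
rewrite /GRing.scale /= ?fctE; apply: (mulfI n2); rewrite mulVKf //.
rewrite (_ : _ - _ = n.+1%:R * sin x ^+ n - (n.+1%:R * sin x ^+ n) * cos x ^+ 2 + sin x ^+ n.+2).
  by rewrite c2 -[in RHS]natr1 !exprS; ring.
by rewrite !exprS; ring.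
Qed.

Lemma sin_primitive0 n : sin_primitive n 0 = 0.
Proof.
suff [] : sin_primitive n 0 = 0 /\ sin_primitive n.+1 0 = 0 by [].
elim: n => [|n [IH1 IH2]]; first by rewrite /= cos0 subrr.
by split=> //=; rewrite IH1 sin0 expr0n /= !mulr0 subr0 mul0r.
Qed.

(** The powers of the sine decrease with the exponent on the interval from 0 to pi / 2. *)
Lemma sin_primitive_le n : sin_primitive n.+1 (pi / 2) <= sin_primitive n (pi / 2).
Proof.
pose f : R -> R := sin_primitive n - sin_primitive n.+1.
have df (x : R) : is_derive x 1 f (sin x ^+ n - sin x ^+ n.+1).
  by have ? := is_derive_sin_primitive n x; have ? := is_derive_sin_primitive n.+1 x;
    apply: is_deriveB.
have pi0 : 0 <= pi / 2 :> R by rewrite divr_ge0 // pi_ge0.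
have fE x : f x = sin_primitive n x - sin_primitive n.+1 x by [].
suff : f 0 <= f (pi / 2) by rewrite !fE !sin_primitive0 subrr subr_ge0.
apply: (@ger0_derive1_ndecr _ f 0 (pi / 2)) => //.
- move=> x; rewrite in_itv /= => /andP[x0 x1]; rewrite derive1E derive_val.
  rewrite exprS -{1}[sin x ^+ n]mul1r -mulrBl mulr_ge0 ?subr_ge0 ?sin_le1 //.
  rewrite exprn_ge0 // sin_ge0_pi // (ltW x0) /=.
  by apply: (le_trans (ltW x1)); rewrite ler_pdivrMr // ler_peMr ?pi_ge0 ?ler1n.
- apply: continuous_subspaceT => x; apply: differentiable_continuous.
  by apply/derivable1_diffP.
Qed.

Lemma sin_primitive_pihalf n :
  sin_primitive (2 * n) (pi / 2) = central_ratio R n * (pi / 2) /\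
  sin_primitive (2 * n).+1 (pi / 2) = ((2 * n%:R + 1) * central_ratio R n)^-1.
Proof.
have h m : 0 <= m%:R :> R by [].
elim: n => [|n [IH1 IH2]].
  by rewrite muln0 /= central_ratio0 mul1r cos_pihalf subr0 mulr0 add0r mulr1 invr1.
have c0 := central_ratio_gt0 R n; have hn := h n.
have recE k : sin_primitive k.+2 (pi / 2) = k.+1%:R / k.+2%:R * sin_primitive k (pi / 2).
  by rewrite /= cos_pihalf mul0r subr0 mulrAC.
rewrite mulnS add2n !recE IH1 IH2 central_ratioS.
have E2 : (2 * n).+1%:R = 2 * n%:R + 1 :> R by rewrite -natr1 natrM.
have E3 : (2 * n).+2%:R = 2 * n%:R + 2 :> R by rewrite -natr1 E2; ring.
have E4 : (2 * n).+3%:R = 2 * n%:R + 3 :> R by rewrite -natr1 E3; ring.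
rewrite E2 E3 E4 -natr1; split; field.
  by apply/eqP; lra.
by repeat (apply/andP; split); apply/eqP; lra.
Qed.

(** The Wallis integral of index 2n + 1 lies between those of indices 2n + 2 and 2n. *)
Lemma central_ratio_square_bounds n :
  2 * n%:R / (2 * n%:R + 1) <= pi * n%:R * central_ratio R n ^+ 2
    <= 2 * n%:R * (2 * n%:R + 2) / (2 * n%:R + 1) ^+ 2.
Proof.
have hn : 0 <= n%:R :> R by [].
have [E1 E2] := sin_primitive_pihalf n; have [E3 _] := sin_primitive_pihalf n.+1.
have := sin_primitive_le (2 * n); have := sin_primitive_le (2 * n).+1.
rewrite -[(2 * n).+2]add2n -mulnS E3 E2 E1 central_ratioS.
have c0 := central_ratio_gt0 R n; set c := central_ratio R n in c0 *.
have p0 : 0 < 2 * n%:R + 1 :> R by lra.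
have p1 : 0 < 2 * n%:R + 2 :> R by lra.
have pc : 0 < (2 * n%:R + 1) * c by rewrite mulr_gt0.
move=> u l; apply/andP; split.
  have {}l : 2 <= pi * c ^+ 2 * (2 * n%:R + 1).
    move: l; rewrite -div1r ler_pdivrMr // => l.
    have -> : pi * c ^+ 2 * (2 * n%:R + 1) = 2 * (c * (pi / 2) * ((2 * n%:R + 1) * c)) by field.
    lra.
  rewrite ler_pdivrMr //.
  have -> : pi * n%:R * c ^+ 2 * (2 * n%:R + 1) = n%:R * (pi * c ^+ 2 * (2 * n%:R + 1)) by ring.
  by rewrite [leLHS]mulrC ler_wpM2l.
have {}u : pi * c ^+ 2 * (2 * n%:R + 1) ^+ 2 <= 2 * (2 * n%:R + 2).
  move: u; rewrite -[leRHS]div1r ler_pdivlMr // => u.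
  have -> : pi * c ^+ 2 * (2 * n%:R + 1) ^+ 2 = 2 * (2 * n%:R + 2) *
      (c * ((2 * n%:R + 1) / (2 * n%:R + 2)) * (pi / 2) * ((2 * n%:R + 1) * c)).
    by field; apply/eqP; lra.
  by rewrite -[leRHS]mulr1 ler_wpM2l // mulr_ge0 // ltW.
rewrite ler_pdivlMr ?exprn_gt0 //.
have -> : pi * n%:R * c ^+ 2 * (2 * n%:R + 1) ^+ 2 =
    n%:R * (pi * c ^+ 2 * (2 * n%:R + 1) ^+ 2) by ring.
have -> : 2 * n%:R * (2 * n%:R + 2) = n%:R * (2 * (2 * n%:R + 2)) :> R by ring.
by rewrite ler_wpM2l.
Qed.

Lemma cvg_central_ratio :
  (fun n => Num.sqrt (pi * n.+1%:R) * central_ratio R n.+1) @ \oo --> (1 : R).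
Proof.
have s1 : (fun n => pi * n.+1%:R * central_ratio R n.+1 ^+ 2) @ \oo --> (1 : R).
  have nz (n : nat) : n.+1%:R != 0 :> R by rewrite pnatr_eq0.
  have hn (n : nat) : 0 < n.+1%:R :> R by [].
  have ch := @cvg_harmonic R.
  apply: (@squeeze_cvgr _ _ _ _ (fun n => 2 / (2 + n.+1%:R^-1))
     (fun n => 2 * (2 + 2 * n.+1%:R^-1) / (2 + n.+1%:R^-1) ^+ 2)).
  - apply: nearW => n; have := central_ratio_square_bounds n.+1.
    have := hn n; set x := n.+1%:R => x0.
    have -> : 2 * x / (2 * x + 1) = 2 / (2 + x^-1).
      by field; apply/andP; split; apply/eqP; lra.
    have -> : 2 * x * (2 * x + 2) / (2 * x + 1) ^+ 2 = 2 * (2 + 2 * x^-1) / (2 + x^-1) ^+ 2 => //.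
    by field; apply/andP; split; apply/eqP; lra.
  - rewrite [X in _ --> X](_ : 1 = 2 / (2 + 0)); last by field.
    apply: cvgM; first exact: cvg_cst.
    apply: cvgV; first by rewrite addr0.
    by apply: cvgD => //; exact: cvg_cst.
  - rewrite [X in _ --> X](_ : 1 = 2 * (2 + 2 * 0) / (2 + 0) ^+ 2); last by field.
    apply: cvgM.
      apply: cvgM; first exact: cvg_cst.
      apply: cvgD; first exact: cvg_cst.
      by apply: cvgM => //; exact: cvg_cst.
    apply: cvgV; first by rewrite addr0 expf_neq0.
    rewrite !expr2; apply: cvgM; apply: cvgD => //; exact: cvg_cst.
rewrite -[X in _ --> X](sqrtr1 R).
rewrite (_ : (fun n => _) = Num.sqrt \o (fun n => pi * n.+1%:R * central_ratio R n.+1 ^+ 2)).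
  by apply: cvg_comp s1 _; apply: sqrt_continuous.
apply/funext => n /=; rewrite [RHS]sqrtrM ?mulr_ge0 ?pi_ge0 //.
by rewrite sqrtr_sqr (ger0_norm (ltW (central_ratio_gt0 _ _))).
Qed.

End Wallis.

(** * Growth of the coefficients and convergence in the disc *)

Section Asymptotics.
Variable R : realType.

Lemma cvg0_affine_rec (E d q : R^nat) (q0 : R) : `|q0| < 2^-1 ->
  (forall n, E n.+1 = d n - q n * E n) ->
  d @ \oo --> (0 : R) -> q @ \oo --> q0 -> E @ \oo --> (0 : R).
Proof.
move=> q0lt rec cd cq; apply/cvgrPdist_lt => e e0.
have [N1 _ HN1] : \forall n \near \oo, `|q n| < 2^-1 by apply: (@cvgr_norm_lt _ R^o _ _ _ q q0 cq).
have e4 : 0 < e / 4 by rewrite divr_gt0.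
have [N2 _ HN2] : \forall n \near \oo, `|d n| < e / 4.
  by apply: (@cvgr_norm_lt _ R^o _ _ _ d 0 cd); rewrite normr0.
pose N := maxn N1 N2.
(* The bound [e / 2] is the fixed point of x -> e / 4 + x / 2. *)
have bd k : `|E (k + N)%N| <= e / 2 + 2^-1 ^+ k * `|E N|.
  elim: k => [|k IH]; first by rewrite add0n expr0 mul1r lerDr; lra.
  have h1 := HN1 (k + N)%N (leq_trans (leq_maxl _ _) (leq_addl _ _)).
  have h2 := HN2 (k + N)%N (leq_trans (leq_maxr _ _) (leq_addl _ _)).
  rewrite /= in h1 h2; rewrite addSn rec; apply: (le_trans (ler_normB _ _)).
  rewrite normrM exprS; have := ler_wpM2r (normr_ge0 (E (k + N)%N)) (ltW h1).
  lra.
have c : (fun k => 2^-1 ^+ k * `|E N|) @ \oo --> (0 : R).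
  rewrite -(mul0r `|E N|); apply: cvgM; last exact: cvg_cst.
  by apply: cvg_expr; rewrite ger0_norm; lra.
have e2 : 0 < e / 2 by rewrite divr_gt0.
have [K _ HK] : \forall k \near \oo, 2^-1 ^+ k * `|E N| < e / 2.
  by apply: (@cvgr_lt R _ _ _ _ 0 c).
exists (K + N)%N => // n /= Kn; rewrite sub0r normrN.
have Nn : (N <= n)%N := leq_trans (leq_addl _ _) Kn.
have := bd (n - N)%N; rewrite subnK //.
have /HK /= : (K <= n - N)%N by rewrite leq_subRL // addnC.
lra.
Qed.

(** The inverse of the growth 12^n / sqrt (pi n^5), which turns equivalents into limits. It vanishes
    at 0, hence the indices [n.+1] below. *)
Definition asymp_scale (n : nat) : R := Num.sqrt (pi * n%:R ^+ 5) / 12 ^+ n.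

Lemma asymp_scale_gt0 n : 0 < asymp_scale n.+1.
Proof. by rewrite divr_gt0 ?exprn_gt0 // sqrtr_gt0 mulr_gt0 ?pi_gt0 ?exprn_gt0. Qed.

Lemma cvg_asymp_scale_ratio : (fun n => asymp_scale n.+2 / asymp_scale n.+1) @ \oo --> (12^-1 : R).
Proof.
rewrite (_ : (fun n => _) = (fun n => Num.sqrt ((1 + n.+1%:R^-1) ^+ 5) / 12)).
  rewrite -[X in _ --> X]mul1r; apply: cvgM; last exact: cvg_cst.
  rewrite -[X in _ --> X](sqrtr1 R).
  have c : (fun n : nat => 1 + n.+1%:R^-1 : R) @ \oo --> (1 : R).
    rewrite -[X in _ --> X]addr0; apply: cvgD; [exact: cvg_cst|exact: cvg_harmonic].
  have c5 : (fun n : nat => (1 + n.+1%:R^-1) ^+ 5 : R) @ \oo --> (1 : R).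
    rewrite -[X in _ --> X](expr1n R 5).
    by apply: (@continuous_cvg _ R R _ _ _ (fun x : R => x ^+ 5) _ _ c); exact: exprn_continuous.
  by apply: (@continuous_cvg _ R R _ _ _ (@Num.sqrt R) _ _ c5); exact: sqrt_continuous.
apply/funext => n.
have n0 : 0 < n.+1%:R :> R by [].
have ->: 1 + n.+1%:R^-1 = n.+2%:R / n.+1%:R :> R.
  by rewrite -[n.+2%:R]natr1; field; apply/eqP; lra.
rewrite /asymp_scale expr_div_n [in RHS]sqrtrM ?exprn_ge0 // sqrtrV ?exprn_ge0 //.
rewrite !(sqrtrM _ (pi_ge0 R)) [12 ^+ n.+2]exprS.
have p0 : Num.sqrt pi != 0 :> R by rewrite gt_eqF // sqrtr_gt0 pi_gt0.
have s0 : Num.sqrt (n.+1%:R ^+ 5) != 0 :> R by rewrite gt_eqF // sqrtr_gt0 exprn_gt0.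
have e0 : 12 ^+ n.+1 != 0 :> R by rewrite expf_neq0.
move: p0 s0 e0; move: (Num.sqrt (n.+1%:R ^+ 5)) (Num.sqrt pi) (12 ^+ n.+1) => a b c a0 b0 c0.
by field; rewrite ?a0 ?b0 ?c0.
Qed.

(** The denominator of [sqrt3_coef] grows like 4 n^2, and [central_ratio] like 1 / sqrt (pi n). *)
Lemma cvg_sqrt3_coef_scale :
  (fun n => sqrt3_coef R n.+1 * 12 ^+ n.+1 * asymp_scale n.+1) @ \oo --> (3 / 4 : R).
Proof.
rewrite (_ : (fun n => _) = (fun n => (Num.sqrt (pi * n.+1%:R) * central_ratio R n.+1) *
   (3 / ((2 - n.+1%:R^-1) * (2 - 3 * n.+1%:R^-1))))).
  rewrite (_ : 3 / 4 = 1 * (3 / ((2 - 0) * (2 - 3 * 0)))); last by field.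
  have ch := @cvg_harmonic R.
  apply: cvgM; first exact: cvg_central_ratio.
  apply: cvgM; first exact: cvg_cst.
  apply: cvgV; first by rewrite mulr0 subr0 mulf_neq0.
  apply: cvgM; first by apply: cvgB; [exact: cvg_cst|exact: ch].
  apply: cvgB; first exact: cvg_cst.
  by apply: cvgM; [exact: cvg_cst|exact: ch].
apply/funext => n; rewrite /sqrt3_coef /asymp_scale.
have n0 : 0 < n.+1%:R :> R by [].
have -> : Num.sqrt (pi * n.+1%:R ^+ 5) = Num.sqrt (pi * n.+1%:R) * n.+1%:R ^+ 2 :> R.
  rewrite (_ : pi * n.+1%:R ^+ 5 = pi * n.+1%:R * (n.+1%:R ^+ 2) ^+ 2); last by ring.
  rewrite sqrtrM ?mulr_ge0 ?pi_ge0 // sqrtr_sqr ger0_norm //.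
have e0 : 12 ^+ n.+1 != 0 :> R by rewrite expf_neq0.
have h1 := odd_natr_neq0 R n.+1 0; have h3 := odd_natr_neq0 R n.+1 1.
rewrite /= muln0 add0n in h1; rewrite muln1 in h3.
have x0 : n.+1%:R != 0 :> R by rewrite gt_eqF.
have y1 : 2 - n.+1%:R^-1 != 0 :> R.
  by rewrite (_ : _ - _ = (2 * n.+1%:R - 1) / n.+1%:R) ?mulf_neq0 ?invr_neq0 //; field.
have y3 : 2 - 3 * n.+1%:R^-1 != 0 :> R.
  by rewrite (_ : _ - _ = (2 * n.+1%:R - 3) / n.+1%:R) ?mulf_neq0 ?invr_neq0 //; field.
have {}h3 : 2 * n.+1%:R - 3 != 0 :> R by exact: h3.
move: x0 h1 h3 e0; move: (Num.sqrt _) (central_ratio R _) (12 ^+ _) {y1 y3 n0} => s c e.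
move: (n.+1%:R) => x x0 h1 h3 e0.
have -> : 3 / ((2 - x^-1) * (2 - 3 * x^-1)) = 3 * x ^+ 2 / ((2 * x - 1) * (2 * x - 3)).
  by field; rewrite h1 h3 x0.
by field; rewrite ?h1 ?h3 ?e0.
Qed.

(** A limit M must satisfy M (1 + 4/12) = L. The deviation from M obeys an affine recurrence whose
    factor tends to 1/3, so it tends to 0. *)
Lemma cvg_shift4_inverse (u b : R^nat) (L : R) :
  (forall n, u n.+1 + 4 * u n = b n.+1) ->
  (fun n => b n.+1 * asymp_scale n.+1) @ \oo --> L ->
  (fun n => u n.+1 * asymp_scale n.+1) @ \oo --> 3 / 4 * L.
Proof.
move=> rec cb.
pose q n := 4 * (asymp_scale n.+2 / asymp_scale n.+1).
have cq : q @ \oo --> (3^-1 : R).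
  rewrite (_ : 3^-1 = 4 * 12^-1); last by field.
  by apply: cvgM; [exact: cvg_cst|exact: cvg_asymp_scale_ratio].
pose M := 3 / 4 * L.
suff : (fun n => u n.+1 * asymp_scale n.+1 - M) @ \oo --> (0 : R).
  by move=> c; apply: cvg_sub0 (cvg_cst M); exact: c.
apply: (@cvg0_affine_rec _ (fun n => b n.+2 * asymp_scale n.+2 - M - q n * M) q 3^-1).
- by rewrite ger0_norm; lra.
- move=> n; have /lt0r_neq0 s0 := asymp_scale_gt0 n; rewrite -rec /q; field.
  exact: s0.
- rewrite (_ : 0 = L - M - 3^-1 * M); last by rewrite /M; field.
  apply: cvgB; last by apply: cvgM => //; exact: cvg_cst.
  apply: cvgB; last exact: cvg_cst.
  by apply/(cvgnS (fun n => b n.+1 * asymp_scale n.+1)).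
- exact: cq.
Qed.

Lemma cvg_excursions_scale :
  (fun n => excursions R (2 * n.+1) * asymp_scale n.+1) @ \oo --> (27 / 128 : R).
Proof.
pose f n := excursions R (2 * n).
pose g := add_shift4 f.
have cb : (fun n => add_shift4 g n.+1 * asymp_scale n.+1) @ \oo --> (3 / 8 : R).
  apply: (@cvg_trans _ ((fun n =>
    2^-1 * (sqrt3_coef R n.+1 * 12 ^+ n.+1 * asymp_scale n.+1)) @ \oo)).
    (* From index 2 on, the polynomial 1 + 36z contributes nothing. *)
    apply: near_eq_cvg; exists 1%N => // n /= n0.
    have := excursions_coef R n.+1; rewrite -/f -/g; case: n n0 => // n _ /=.
    rewrite addr0 mulr0 addr0 => <-; by field.
  rewrite (_ : 3 / 8 = 2^-1 * (3 / 4)); last by field.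
  by apply: cvgM; [exact: cvg_cst|exact: cvg_sqrt3_coef_scale].
have cg := @cvg_shift4_inverse g _ _ (fun n => erefl) cb.
have cf := @cvg_shift4_inverse f _ _ (fun n => erefl) cg.
by rewrite (_ : 27 / 128 = 3 / 4 * (3 / 4 * (3 / 8))); last by field.
Qed.

(** Division by 1 + 4z at most doubles the constant, since 12 + 4 * 2 is at most 2 * 12. *)
Lemma shift4_inverse_bound (u b : R^nat) (K : R) : 0 <= K ->
  (forall n, add_shift4 u n = b n) -> (forall n, `|b n| <= K * 12 ^+ n) ->
  forall n, `|u n| <= 2 * K * 12 ^+ n.
Proof.
move=> K0 rec bd; elim=> [|n IH].
  have := bd 0%N; rewrite -rec /add_shift4 /= mulr0 addr0 expr0 !mulr1; lra.
have -> : u n.+1 = b n.+1 - 4 * u n by rewrite -rec /add_shift4 /= addrK.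
apply: (le_trans (ler_normB _ _)); rewrite normrM (ger0_norm (_ : 0 <= 4)) //.
have := bd n.+1; have : 0 <= K * 12 ^+ n by rewrite mulr_ge0 ?exprn_ge0.
rewrite exprS; lra.
Qed.

(** The right-hand side has constant 4, and the two divisions by 1 + 4z give 8 and 16. This yields
    convergence for |z| < 1/12, whatever the sign of z. *)
Lemma excursions_bound n : excursions R (2 * n) <= 16 * 12 ^+ n.
Proof.
pose f n := excursions R (2 * n).
have bs m : `|sqrt_coef R m| <= 2.
  have := series_norm_sqrt_coef R m; rewrite seriesSr => E.
  have c0 := central_ratio_gt0 R m.
  have : 0 <= series (fun n => `|sqrt_coef R n|) m by apply: sumr_ge0.
  lra.
have b3 m : `|sqrt3_coef R m| <= 4.
  rewrite sqrt3_coefE; apply: (le_trans (ler_normB _ _)).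
  have := bs m; case: m => [|m] /=; rewrite ?normr0; first by lra.
  by have := bs m; lra.
pose b := add_shift4 (add_shift4 f).
have bb m : `|b m| <= 4 * 12 ^+ m.
  have E := excursions_coef R m; rewrite -/f -/b in E.
  have -> : b m = 2^-1 * (sqrt3_coef R m * 12 ^+ m + (m == 0%N)%:R + 36 * (m == 1%N)%:R).
    by rewrite -E; field.
  rewrite normrM (ger0_norm (_ : 0 <= 2^-1)) //.
  have h : `|(m == 0%N)%:R + 36 * (m == 1%N)%:R| <= 4 * 12 ^+ m :> R.
    case: m {E} => [|[|m]] /=.
    - by rewrite ger0_norm; lra.
    - by rewrite ger0_norm; lra.
    - by rewrite mulr0 addr0 normr0 mulr_ge0 ?exprn_ge0.
  have := ler_normD (sqrt3_coef R m * 12 ^+ m) ((m == 0%N)%:R + 36 * (m == 1%N)%:R).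
  rewrite addrA normrM (ger0_norm (exprn_ge0 m _)) //.
  have := ler_wpM2r (exprn_ge0 m (ler0n R 12)) (b3 m).
  lra.
have k4 : 0 <= 4 :> R by [].
have g8 := shift4_inverse_bound k4 (fun n => erefl) bb.
have k8 : 0 <= 2 * 4 :> R by [].
have := shift4_inverse_bound k8 (fun n => erefl) g8 n.
rewrite /f ger0_norm ?excursions_ge0 // => /le_trans; apply.
by apply: ler_wpM2r; rewrite ?exprn_ge0 //; lra.
Qed.

Lemma cvg_excursions_pow (z : R) : 0 < `|z| -> `|z| < 12^-1 ->
  series (fun n => excursions R (2 * n) * z ^+ n) @ \oo -->
    54 * z / (1 + 36 * z - (1 - 12 * z) `^ (3 / 2)).
Proof.
move=> z0 z1; pose f n := excursions R (2 * n).
have cv : cvgn (series (fun n => f n * z ^+ n)).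
  have cn : cvgn (series (fun n => `|f n * z ^+ n|)).
    apply: (@series_le_cvg _ _ (geometric 16 (12 * `|z|))) => // n.
    - by rewrite /= mulr_ge0 // exprn_ge0 // mulr_ge0.
    - rewrite /= normrM normrX exprMn mulrA ler_wpM2r ?exprn_ge0 //.
      by rewrite ger0_norm ?excursions_ge0 ?excursions_bound.
    - by apply: is_cvg_geometric_series; rewrite ger0_norm; have := normr_ge0 z; lra.
  exact: normed_cvg.
pose S := limn (series (fun n => f n * z ^+ n)).
have {}cv : series (fun n => f n * z ^+ n) @ \oo --> S by exact: cv.
have cg := cvg_add_shift4 (cvg_add_shift4 cv).
have [z2 z3] : - 12^-1 < z /\ z < 12^-1 by move: z1; rewrite ltr_norml => /andP[].
have c12 : series (fun k => sqrt3_coef R k * 12 ^+ k * z ^+ k) @ \oo -->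
    (1 - 12 * z) * Num.sqrt (1 - 12 * z).
  rewrite (_ : (fun k => _) = (fun k => sqrt3_coef R k * (12 * z) ^+ k)).
    by apply: cvg_sqrt3_series; rewrite ltr_norml; apply/andP; split; lra.
  by apply/funext => k; rewrite exprMn mulrA.
have cp : series (fun k => ((k == 0%N)%:R + 36 * (k == 1%N)%:R) * z ^+ k) @ \oo --> 1 + 36 * z.
  exact: cvg_initial_terms.
have S2 : 2 * ((1 + 4 * z) * ((1 + 4 * z) * S)) =
    (1 - 12 * z) * Num.sqrt (1 - 12 * z) + (1 + 36 * z).
  have c1 : (fun n => 2 * series (fun n => add_shift4 (add_shift4 f) n * z ^+ n) n) @ \oo -->
      2 * ((1 + 4 * z) * ((1 + 4 * z) * S)) by apply: cvgM => //; exact: cvg_cst.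
  have c2 := cvgD c12 cp.
  apply: (@cvg_unique _ (@Rhausdorff R) _ _ _ _ c1).
  suff -> : (fun x => 2 * series (fun n => add_shift4 (add_shift4 f) n * z ^+ n) x) =
    (series (fun k => sqrt3_coef R k * 12 ^+ k * z ^+ k) +
     series (fun k => ((k == 0%N)%:R + 36 * (k == 1%N)%:R) * z ^+ k)) by exact: c2.
  rewrite -seriesD; apply/funext => m; rewrite /series /= mulr_sumr; apply: eq_bigr => k _.
  by rewrite fctE mulrA excursions_coef; ring.
suff -> : 54 * z / (1 + 36 * z - (1 - 12 * z) `^ (3 / 2)) = S by [].
have p0 : 0 < 1 - 12 * z by lra.
have -> : (1 - 12 * z) `^ (3 / 2) = (1 - 12 * z) * Num.sqrt (1 - 12 * z).
  rewrite (_ : 3 / 2 = 1 + 2^-1); last by field.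
  by rewrite powRD ?(gt_eqF p0) ?implybT // powRr1 ?ltW // powR12_sqrt // ltW.
move: S2.
(* Both closed forms are rational in [w]. The factor 1 - w is nonzero because z is, and 2 - w
   because w^2 < 2. *)
set w := Num.sqrt _ => S2.
have w0 : 0 < w by rewrite sqrtr_gt0.
have w2 : w ^+ 2 = 1 - 12 * z by rewrite sqr_sqrtr // ltW.
have zE : z = (1 - w ^+ 2) / 12 by rewrite w2; field.
have wn1 : 1 - w != 0.
  apply/eqP => E; move: z0; rewrite zE (_ : w = 1) ?expr1n ?subrr ?mul0r ?normr0 ?ltxx //; lra.
have wn2 : 2 - w != 0 by apply/eqP => E; nra.
have wp : 2 + w != 0 by apply/eqP => E; lra.
have S3 : S = 9 * (1 + w) / (2 * (2 + w) ^+ 2).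
  have E : S * (2 / 9 * (2 - w) ^+ 2 * (2 + w) ^+ 2) = (2 - w) ^+ 2 * (1 + w).
    have -> : (2 - w) ^+ 2 * (1 + w) = w ^+ 2 * w + (1 + 36 * ((1 - w ^+ 2) / 12)) by field.
    by rewrite -zE w2 -S2 {1 2}zE; field.
  have {}E : S = (2 - w) ^+ 2 * (1 + w) / (2 / 9 * (2 - w) ^+ 2 * (2 + w) ^+ 2).
    by rewrite -E mulfK // !mulf_neq0 ?expf_neq0 ?invr_neq0.
  by rewrite E; field; rewrite wn2 wp.
rewrite S3 -w2 zE.
have -> : 1 + 36 * ((1 - w ^+ 2) / 12) - w ^+ 2 * w = (1 - w) * (2 + w) ^+ 2 by field.
by field; rewrite wn1 wp.
Qed.

End Asymptotics.

(** * From excursions back to 312-avoiding matchings *)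

Lemma card_matchings_excursions (R : realType) n :
  #|matchings_avoiding n p312|%:R = excursions R (2 * n).
Proof. by rewrite card_matchings_312 walks_natr. Qed.

Theorem theorem4p1 (R : realType) :
  (forall z : R, 0 < `|z| -> `|z| < 12^-1 ->
     series (fun n : nat => #|matchings_avoiding n p312|%:R * z ^+ n) @ \oo -->
       54 * z / (1 + 36 * z - (1 - 12 * z) `^ (3 / 2)))
  /\
  (fun n : nat => #|matchings_avoiding n p312|%:R : R) ~_\oo
    (fun n : nat => 3 ^+ 3 / (2 ^+ 7 * Num.sqrt (pi * n%:R ^+ 5)) * 12 ^+ n).
Proof.
split.
  move=> z z0 z1; rewrite (_ : (fun n => _) = (fun n => excursions R (2 * n) * z ^+ n)).
    exact: cvg_excursions_pow.
  by apply/funext => n; rewrite card_matchings_excursions.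
set f := fun n : nat => _; set g := fun n : nat => _ * _.
apply/eqaddoP => e e0.
have c := @cvg_excursions_scale R.
(* A relative error [e] is an absolute error [e * (27 / 128)] after scaling, since the comparison
   sequence is 27 / 128 divided by [asymp_scale]. *)
have e1 : 0 < e * (27 / 128) by rewrite mulr_gt0.
move/cvgrPdist_lt/(_ _ e1): c => [N _ HN].
exists N.+1 => // -[//|n] /= Nn.
have := HN n Nn; have s0 := asymp_scale_gt0 R n; have -> : (f - g) n.+1 = f n.+1 - g n.+1 by [].
have -> : g n.+1 = 27 / 128 / asymp_scale R n.+1.
  have : Num.sqrt (pi * n.+1%:R ^+ 5) != 0 :> R.
    by rewrite gt_eqF // sqrtr_gt0 mulr_gt0 ?pi_gt0 ?exprn_gt0.
  have : 12 ^+ n.+1 != 0 :> R by rewrite expf_neq0.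
  by rewrite /g /asymp_scale; move: (Num.sqrt _) (12 ^+ _) => s q q0 q1; field; rewrite q0 q1.
rewrite /f card_matchings_excursions /=.
move: (excursions R _) (asymp_scale R _) s0 => x s s0 Hx.
have sn := lt0r_neq0 s0.
have -> : x - 27 / 128 / s = - (27 / 128 - x * s) / s by field.
rewrite !normrM normrN !normfV (gtr0_norm s0) mulrA ler_wpM2r ?invr_ge0 ?(ltW s0) //.
by rewrite -normfV -normrM [X in _ <= _ * X]ger0_norm // ltW.
Qed.
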